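(* Let $H:[0,T]\times\mathbb{R}^n\times\mathbb{R}^n\to\mathbb{R}$ be such that $H(\cdot,x,p)$ is measurable for all $(x,p)$, $H(t,\cdot,\cdot)$ is continuous for every $t$, $H(t,x,\cdot)$ is convex for every $(t,x)$, and there is a measurable $c:[0,T]\to[0,\infty)$ with $|H(t,x,p)-H(t,x,q)|\le c(t)(1+|x|)|p-q|$ for all $(t,x)\in[0,T]\times\mathbb{R}^n$, $p,q\in\mathbb{R}^n$. Suppose that for every $R>0$ there are a measurable $k_R:[0,T]\to[0,\infty)$, a modulus $w_R$ and a null set $\mathcal{N}_R\subset[0,T]$ such that $$|H(t,x,p)-H(t,y,p)|\le k_R(t)\,|p|\,|x-y|+w_R(t,|x-y|)\quad\text{for all } t\in[0,T]\setminus\mathcal{N}_R,\ x,y\in B_R,\ p\in\mathbb{R}^n .$$ Let $L(t,x,v):=\sup_{p\in\mathbb{R}^n}\{\langle v,p\rangle-H(t,x,p)\}$, and suppose there is $\lambda:[0,T]\times\mathbb{R}^n\to\mathbb{R}$, measurable in $t$ for all $x$ and continuous in $x$ for all $t$, such that $L(t,x,v)\le\lambda(t,x)$ for all $t\in[0,T]$, $x\in\mathbb{R}^n$, $v\in\mathrm{dom}\,L(t,x,\cdot)$, and such that for every $R>0$ there are a modulus $\tilde w_R$ and a null set $\tilde{\mathcal{N}}_R$ with $|\lambda(t,x)-\lambda(t,y)|\le\tilde w_R(t,|x-y|)$ for all $t\in[0,T]\setminus\tilde{\mathcal{N}}_R$, $x,y\in B_R$. Let $A:=B$ be the closed unit ball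 of $\mathbb{R}^{n+1}$ and $M(t,x):=|\lambda(t,x)|+|H(t,x,0)|+c(t)(1+|x|)+1$. Then there exist $f:[0,T]\times\mathbb{R}^n\times A\to\mathbb{R}^n$ and $l:[0,T]\times\mathbb{R}^n\times A\to\mathbb{R}$, measurable in $t$ for all $(x,a)\in\mathbb{R}^n\times A$ and continuous in $(x,a)$ for all $t\in[0,T]$, such that for all $t\in[0,T]$, $x,p\in\mathbb{R}^n$ $$H(t,x,p)=\sup_{a\in B}\{\langle p,f(t,x,a)\rangle-l(t,x,a)\}$$ and $f(t,x,A)=\mathrm{dom}\,L(t,x,\cdot)$. Moreover: (A1) for every $R>0$ and all $t\in[0,T]\setminus\mathcal{N}_R$, $x,y\in B_R$, $a,b\in B$: $|f(t,x,a)-f(t,y,a)|\le10(n+1)[\,k_R(t)|x-y|+w_R(t,|x-y|)+|M(t,x)-M(t,y)|\,]$ and $|f(t,x,a)-f(t,x,b)|\le10(n+1)M(t,x)|a-b|$; (A2) $|f(t,x,a)|\le c(t)(1+|x|)$ for all $t\in[0,T]$, $x\in\mathbb{R}^n$, $a\in B$; (A3) for every $R>0$ and all $t\in[0,T]\setminus\mathcal{N}_R$, $x,y\in B_R$, $a,b\in B$: $|l(t,x,a)-l(t,y,a)|\le10(n+1)[\,k_R(t)|x-y|+w_R(t,|x-y|)+|M(t,x)-M(t,y)|\,]$ and $|l(t,x,a)-l(t,x,b)|\le10(n+1)M(t,x)|a-b|$; (A4) if $H$, $\lambda$ and $c$ are continuous (jointly in all their variables), then so are $f$ and $l$.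
   Context: $|\cdot|$ is the Euclidean norm, $\langle\cdot,\cdot\rangle$ the scalar product, and $B_R$ is the closed ball in $\mathbb{R}^n$ centered at $0$ with radius $R$. Measurable means Lebesgue measurable and a null set is a set of Lebesgue measure zero. A modulus is a function $w:[0,T]\times[0,\infty)\to[0,\infty)$ such that $w(\cdot,r)$ is measurable for every $r\ge0$ and, for every $t\in[0,T]$, $w(t,\cdot)$ is nondecreasing, continuous, subadditive and $w(t,0)=0$. $\mathrm{dom}\,\varphi:=\{x:\varphi(x)\ne\pm\infty\}$. *)

(* Defs.v *)
From HB Require Import structures.
From mathcomp Require Import all_boot all_order all_algebra.
From mathcomp Require Import all_classical all_reals all_analysis.
From mathcomp Require Import measurable_realfun.

Set Implicit Arguments.
Unset Strict Implicit.
Unset Printing Implicit Defensive.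

Import Order.TTheory GRing.Theory Num.Theory.
Import numFieldNormedType.Exports.

Local Open Scope classical_set_scope.
Local Open Scope ring_scope.

(* The library norm `|x| on 'rV[R]_n is the sup norm, so the Euclidean structure
   is given here; the library topology on 'rV[R]_n is the Euclidean one. *)
Definition dotv (R : realType) (n : nat) (u v : 'rV[R]_n) : R :=
  \sum_(i < n) u 0 i * v 0 i.

Definition enorm (R : realType) (n : nat) (u : 'rV[R]_n) : R :=
  Num.sqrt (dotv u u).

Definition eball (R : realType) (n : nat) (r : R) : set 'rV[R]_n :=
  [set x | enorm x <= r].

(* The real line with its Lebesgue sigma-algebra, i.e. the completion of the
   Borel one: the library's measurable structure on R itself is Borel. *)
Definition lebesgueTypeR (R : realType) :=
  g_sigma_algebraType (completed_algebra_gen (@lebesgue_measure R)).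

Definition lebesgue_measurable_fun (R : realType) (D : set R) (f : R -> R) :=
  measurable_fun (D : set (lebesgueTypeR R)) (f : lebesgueTypeR R -> R).

(* 'rV[R]_n is endowed with the Borel sigma-algebra of its topology. *)
Definition lebesgue_measurable_vfun (R : realType) (n : nat) (D : set R)
    (f : R -> 'rV[R]_n) :=
  measurable_fun (D : set (lebesgueTypeR R))
    (f : lebesgueTypeR R -> g_sigma_algebraType (@open 'rV[R]_n)).

(* Functions on [0, T] (or [0, +oo[) are represented by functions on R, of which
   only the values on that interval matter. *)
Definition modulus (R : realType) (T : R) (w : R -> R -> R) :=
  [/\ forall t r : R, 0 <= t <= T -> 0 <= r -> 0 <= w t r,
      forall r : R, 0 <= r -> lebesgue_measurable_fun `[0, T] (w ^~ r) &
      forall t : R, 0 <= t <= T ->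
        [/\ forall r s : R, 0 <= r -> r <= s -> w t r <= w t s,
            {within `[0, +oo[, continuous (w t)},
            forall r s : R, 0 <= r -> 0 <= s -> w t (r + s) <= w t r + w t s &
            w t 0 = 0]].

Definition null_subset (R : realType) (T : R) (N : set R) :=
  N `<=` `[0, T] /\ (@lebesgue_measure R).-negligible N.

Definition lagrangian (R : realType) (n : nat)
    (H : R -> 'rV[R]_n -> 'rV[R]_n -> R) (t : R) (x v : 'rV[R]_n) : \bar R :=
  ereal_sup [set (dotv v p - H t x p)%:E | p in [set: 'rV[R]_n]].

Definition edom (R : realType) (n : nat) (phi : 'rV[R]_n -> \bar R) :
    set 'rV[R]_n :=
  [set x | phi x != +oo%E /\ phi x != -oo%E].

Definition Mbound (R : realType) (n : nat)
    (H : R -> 'rV[R]_n -> 'rV[R]_n -> R) (lam : R -> 'rV[R]_n -> R)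
    (c : R -> R) (t : R) (x : 'rV[R]_n) : R :=
  `|lam t x| + `|H t x 0| + c t * (1 + enorm x) + 1.

(* Main.v *)
Require Import Defs.
From HB Require Import structures.
From mathcomp Require Import all_boot all_order all_algebra.
From mathcomp Require Import all_classical all_reals all_analysis.
From mathcomp Require Import measurable_realfun.
From mathcomp Require Import ring lra.

Set Implicit Arguments.
Unset Strict Implicit.
Unset Printing Implicit Defensive.

Import Order.TTheory GRing.Theory Num.Theory.
Import numFieldNormedType.Exports.

Local Open Scope classical_set_scope.
Local Open Scope ring_scope.

(** The points [(l, f)] that represent [H t x] are taken in the epigraph of the
    Lagrangian, a closed convex subset of the space of dimension [n + 1]; it is
    [conj_epi (H t x)] below, the head coordinate being the height.  Since [H] is
    its own biconjugate ([conj_epi_support]), the supremum of [<p, f> - l] over any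
    part of the epigraph that contains the graph of the Lagrangian is [H t x p].  By
    the bound [lam] on the Lagrangian and the Lipschitz constant of [H] in [p], this
    graph lies in the ball of radius [M t x].  It is therefore enough to retract
    this ball onto (part of) the epigraph by a map that is the identity on the
    epigraph and is Lipschitz both in the point and in the epigraph, and to
    precompose it with the dilation [a |-> M t x *: a].

    The nearest point is only a Hoelder continuous function of a convex
    set, so the retraction [selection] is made in two steps, as for the Steiner
    point.  The portion [near_set] of the epigraph lying within twice
    the distance from [y] is a Lipschitz function of [y] and of the epigraph for
    the Hausdorff distance, with constant 10 ([near_set_lipschitz]).  In that compact
    convex set a point is singled out by averaging over a cube the gradient of the
    support function ([cube_mean]).  The gradient is a point of the set where it
    exists, hence so is its mean; integrating in one direction shows that each
    coordinate of the mean is an average of differences of the support function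
    between opposite faces of the cube, hence a Lipschitz function of the
    set, with constant the dimension.  The mean is taken as a limit over dyadic
    grids, on which the same telescoping of differences is a finite identity
    ([sign_avg_cdiff]).

    The distance between two epigraphs is read off the Hamiltonians: the distance
    from a point to an epigraph is the largest violation of the inequalities
    [<p, v> - eta <= H p], divided by [|(p, -1)|] ([conj_epi_dist]).  The assumed
    estimate of [H t x p - H t y p] gives the bounds in the state variable.  For
    continuity, where no uniform estimate is available for large [p], convexity of
    [H] shows that slopes beyond a radius [s] contribute at most a multiple of
    [1 / s] on bounded sets ([conj_epi_local_excess]), so that locally uniform
    convergence suffices ([selection_cvg]).

    For measurability in [t], the support function of [near_set] is rewritten as
    an unconstrained supremum with an exact penalty ([supp_near_set_penalty]); all
    suprema involved are of continuous functions, so they run over rational vectors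
    only, and the mean over the cube is a limit of finite sums. *)

(** * Euclidean geometry of row vectors *)

Section Euclid.
Context {R : realType} {n : nat}.
Implicit Types (u v w : 'rV[R]_n) (a : R).

Lemma dotvC u v : dotv u v = dotv v u.
Proof. by apply: eq_bigr => i _; rewrite mulrC. Qed.

Lemma dotvDl u v w : dotv (u + v) w = dotv u w + dotv v w.
Proof. by rewrite -big_split; apply: eq_bigr => i _; rewrite mxE mulrDl. Qed.

Lemma dotvZl a u v : dotv (a *: u) v = a * dotv u v.
Proof. by rewrite mulr_sumr; apply: eq_bigr => i _; rewrite mxE mulrA. Qed.

Lemma dotvDr u v w : dotv u (v + w) = dotv u v + dotv u w.
Proof. by rewrite !(dotvC u) dotvDl. Qed.

Lemma dotvZr a u v : dotv u (a *: v) = a * dotv u v.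
Proof. by rewrite !(dotvC u) dotvZl. Qed.

Lemma dotvNl u v : dotv (- u) v = - dotv u v.
Proof. by rewrite -scaleN1r dotvZl mulN1r. Qed.

Lemma dotvNr u v : dotv u (- v) = - dotv u v.
Proof. by rewrite !(dotvC u) dotvNl. Qed.

Lemma dotvBl u v w : dotv (u - v) w = dotv u w - dotv v w.
Proof. by rewrite dotvDl dotvNl. Qed.

Lemma dotvBr u v w : dotv u (v - w) = dotv u v - dotv u w.
Proof. by rewrite dotvDr dotvNr. Qed.

Lemma dotv0l u : dotv 0 u = 0.
Proof. by rewrite -(scale0r u) dotvZl mul0r. Qed.

Lemma dotv0r u : dotv u 0 = 0.
Proof. by rewrite dotvC dotv0l. Qed.

Lemma dotvv_ge0 u : 0 <= dotv u u.
Proof. by apply: sumr_ge0 => i _; rewrite -expr2 sqr_ge0. Qed.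

Lemma enorm_ge0 u : 0 <= enorm u.
Proof. exact: sqrtr_ge0. Qed.

Lemma sqr_enorm u : enorm u ^+ 2 = dotv u u.
Proof. by rewrite sqr_sqrtr // dotvv_ge0. Qed.

Lemma enormZ a u : enorm (a *: u) = `|a| * enorm u.
Proof.
by rewrite /enorm dotvZl dotvZr mulrA -expr2 sqrtrM ?sqr_ge0// sqrtr_sqr.
Qed.

Lemma enormN u : enorm (- u) = enorm u.
Proof. by rewrite -scaleN1r enormZ normrN1 mul1r. Qed.

Lemma enormBC u v : enorm (u - v) = enorm (v - u).
Proof. by rewrite -enormN opprB. Qed.

Lemma enorm0 : enorm (0 : 'rV[R]_n) = 0.
Proof. by rewrite /enorm dotv0l sqrtr0. Qed.

Lemma normr_coord_le_enorm u i : `|u 0 i| <= enorm u.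
Proof.
rewrite -(ger0_norm (enorm_ge0 u)) -ler_sqr ?nnegrE// !real_normK ?num_real//.
rewrite sqr_enorm /dotv (bigD1 i)//= -expr2 lerDl.
by apply: sumr_ge0 => j _; rewrite -expr2 sqr_ge0.
Qed.

Lemma enorm_eq0 u : enorm u = 0 -> u = 0.
Proof.
move=> u0; apply/rowP => i; rewrite mxE; apply/eqP.
by rewrite -normr_le0 -u0 normr_coord_le_enorm.
Qed.

Lemma cauchy_schwarz u v : dotv u v <= enorm u * enorm v.
Proof.
have [/enorm_eq0->|u0] := eqVneq (enorm u) 0; first by rewrite dotv0l enorm0 mul0r.
have [/enorm_eq0->|v0] := eqVneq (enorm v) 0; first by rewrite dotv0r enorm0 mulr0.
have uv : 0 < enorm u * enorm v by rewrite mulr_gt0// lt_def ?u0 ?v0 enorm_ge0.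
have := dotvv_ge0 (enorm v *: u - enorm u *: v).
rewrite !(dotvBl, dotvBr, dotvZl, dotvZr) -!sqr_enorm (dotvC v u).
set a := enorm u; set b := enorm v; set d := dotv u v => h.
rewrite -subr_ge0 -(pmulr_rge0 _ uv) -/a -/b; nra.
Qed.

Lemma enormD u v : enorm (u + v) <= enorm u + enorm v.
Proof.
rewrite -ler_sqr ?nnegrE ?addr_ge0 ?enorm_ge0// sqr_enorm !(dotvDl, dotvDr).
rewrite (dotvC v u) sqrrD !sqr_enorm; have := cauchy_schwarz u v; lra.
Qed.

Lemma enorm_triangle u v w : enorm (u - w) <= enorm (u - v) + enorm (v - w).
Proof. by rewrite -[u - w](subrKA v) enormD. Qed.

Lemma enorm_le_sum u : enorm u <= \sum_(i < n) `|u 0 i|.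
Proof.
rewrite -ler_sqr ?nnegrE ?enorm_ge0 ?sumr_ge0// sqr_enorm expr2 mulr_suml.
apply: ler_sum => i _; rewrite (le_trans (ler_norm _))// normrM.
by rewrite ler_wpM2l// (bigD1 i)//= lerDl sumr_ge0.
Qed.

Lemma enorm_le_coord u a : 0 <= a ->
  (forall i, `|u 0 i| <= a) -> enorm u <= Num.sqrt n%:R * a.
Proof.
move=> a0 ua; rewrite -ler_sqr ?nnegrE ?mulr_ge0 ?enorm_ge0 ?sqrtr_ge0//.
rewrite sqr_enorm exprMn sqr_sqrtr ?ler0n// mulr_natl.
rewrite -[X in _ *+ X](card_ord n) -sumr_const; apply: ler_sum => i _.
by rewrite -expr2 -(real_normK (num_real (u 0 i))) ler_sqr ?nnegrE.
Qed.

Lemma normr_coord_le_mx_norm u i : `|u 0 i| <= `|u|.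
Proof.
rewrite [leRHS]/Num.Def.normr /= mx_normrE; apply/bigmax_geP; right => /=.
by exists (0, i).
Qed.

Lemma enorm_le_mx_norm u : enorm u <= n%:R * `|u|.
Proof.
apply: le_trans (enorm_le_sum u) _.
rewrite mulr_natl -[X in _ *+ X](card_ord n) -sumr_const; apply: ler_sum => i _.
exact: normr_coord_le_mx_norm.
Qed.

Lemma mx_norm_le_enorm u : `|u| <= enorm u.
Proof.
rewrite [leLHS]/Num.Def.normr /= mx_normrE; apply/bigmax_leP; split=> [|[i j] _ /=].
  exact: enorm_ge0.
by rewrite ord1 normr_coord_le_enorm.
Qed.

Lemma continuous_dotv v : continuous (dotv v : 'rV[R]_n -> R).
Proof.
have vi_cont (i : 'I_n) : xpredT i -> continuous (fun u : 'rV[R]_n => v 0 i * u 0 i).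
  by move=> _ u; apply: continuousM; [exact: cst_continuous|exact: coord_continuous].
exact: (@continuous_big R _ +%R 0 xpredT (@add_continuous R) _ _ _ vi_cont).
Qed.

Lemma continuous_dotvl v : continuous ((@dotv R n)^~ v).
Proof.
have -> : (@dotv R n)^~ v = dotv v by apply/funext => u; rewrite dotvC.
exact: continuous_dotv.
Qed.

Lemma continuous_enorm : continuous (@enorm R n).
Proof.
have sqi_cont (i : 'I_n) : xpredT i -> continuous (fun u : 'rV[R]_n => u 0 i * u 0 i).
  by move=> _ u; apply: continuousM; exact: coord_continuous.
have sq_cont : continuous (fun u : 'rV[R]_n => dotv u u).
  exact: (@continuous_big R _ +%R 0 xpredT (@add_continuous R) _ _ _ sqi_cont).
by move=> u; apply: continuous_comp; [exact: sq_cont|exact: sqrt_continuous].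
Qed.

Lemma continuous_enormB v : continuous (fun u => enorm (u - v)).
Proof.
move=> u; apply: (continuous_comp (f := fun u => u - v)).
  by apply: continuousB; [exact: cvg_id|exact: cst_continuous].
exact: continuous_enorm.
Qed.

Lemma cvg_enormP {T : Type} (F : set_system T) (FF : Filter F)
    (f : T -> 'rV[R]_n) (l : 'rV[R]_n) :
  f @ F --> l <-> forall e, 0 < e -> \forall x \near F, enorm (f x - l) <= e.
Proof.
split=> [fl e e0|fl].
  have e'0 : 0 < e / n.+1%:R by rewrite divr_gt0.
  have /cvgrPdist_le/(_ _ e'0) := fl; apply: filterS => x xe.
  rewrite enormBC (le_trans (enorm_le_mx_norm _))//.
  rewrite (@le_trans _ _ (n.+1%:R * `|l - f x|))// ?ler_wpM2r// ?ler_nat//.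
  by rewrite mulrC -ler_pdivlMr.
apply/cvgrPdist_le => e e0; have := fl _ e0; apply: filterS => x.
by rewrite enormBC; apply: le_trans (mx_norm_le_enorm _).
Qed.

Lemma near_enorm_le u (e : R) : 0 < e -> nbhs u [set v | enorm (v - u) <= e].
Proof.
move=> e0; have : id @ u --> u by exact: cvg_id.
by move=> /(@cvg_enormP _ _ (nbhs_filter u))/(_ _ e0).
Qed.

Lemma bounded_set_enorm (C : set 'rV[R]_n) a :
  (forall u, C u -> enorm u <= a) -> bounded_set C.
Proof.
move=> Ca; exists a; split; first exact: num_real.
move=> b ab u /Ca ua; apply: le_trans (mx_norm_le_enorm _) _.
exact: le_trans ua (ltW ab).
Qed.

Lemma compact_enorm_ball a : compact (eball a : set 'rV[R]_n).
Proof.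
apply: bounded_closed_compact; first exact: (@bounded_set_enorm _ a).
apply: (@closed_comp _ _ (@enorm R n) [set x | x <= a]); last exact: closed_le.
by move=> u _; exact: continuous_enorm.
Qed.

End Euclid.

(** * Closed convex sets *)

Section ConvexSets.
Context {R : realType} {n : nat}.
Implicit Types (u v w y z : 'rV[R]_n) (C : set 'rV[R]_n).

Definition convex_combs C := forall u v (a : R),
  C u -> C v -> 0 <= a <= 1 -> C (a *: u + (1 - a) *: v).

Lemma nearest_point C z : closed C -> C !=set0 ->
  exists2 u, C u & forall w, C w -> enorm (z - u) <= enorm (z - w).
Proof.
move=> Ccl [w0 Cw0].
pose D := C `&` [set w | enorm (w - z) <= enorm (w0 - z)].
have dist_cont := @continuous_enormB _ _ z.
have Dcl : closed D.
  apply: closedI => //.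
  apply: (@closed_comp _ _ (fun w => enorm (w - z)) [set x | x <= enorm (w0 - z)]).
    by move=> w _; exact: dist_cont.
  exact: closed_le.
have Dbd : bounded_set D.
  apply: (@bounded_set_enorm _ _ _ (enorm (w0 - z) + enorm z)) => w [_ /= wz].
  by rewrite -[w](subrK z) (le_trans (enormD _ _))// lerD2r.
have D0 : D !=set0 by exists w0; split=> //=.
have [] := EVT_min_rV D0 (bounded_closed_compact Dbd Dcl) (continuous_subspaceT dist_cont).
move=> u; rewrite inE => -[Cu uw0] umin; exists u => // w Cw.
rewrite enormBC (enormBC z); have [ww0|/ltW ww0] := leP (enorm (w - z)) (enorm (w0 - z)).
  by apply: umin; rewrite inE.
exact: le_trans uw0 ww0.
Qed.

Lemma nearest_point_obtuse C z u w : convex_combs C -> C u ->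
  (forall w, C w -> enorm (z - u) <= enorm (z - w)) -> C w ->
  dotv (z - u) (w - u) <= 0.
Proof.
move=> Ccvx Cu umin Cw; rewrite leNgt; apply/negP.
set d := dotv _ _ => d0; pose s := dotv (w - u) (w - u).
have s0 : 0 <= s by exact: dotvv_ge0.
(* moving from u towards w by this fraction decreases the distance to z *)
pose a := d / (s + d).
have sd0 : 0 < s + d by lra.
have a0 : 0 < a by exact: divr_gt0.
have a1 : a <= 1 by rewrite ler_pdivrMr// mul1r; lra.
have aE : a * (s + d) = d by rewrite /a divfK// gt_eqF.
have := umin _ (Ccvx w u a Cw Cu _); rewrite (ltW a0) a1 => /(_ isT).
have -> : z - (a *: w + (1 - a) *: u) = (z - u) - a *: (w - u).
  by apply/rowP => i; rewrite !mxE; ring.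
rewrite -ler_sqr ?nnegrE ?enorm_ge0// !sqr_enorm.
have -> Z W : dotv (Z - a *: W) (Z - a *: W) =
    dotv Z Z - 2 * (a * dotv Z W) + a * (a * dotv W W).
  by rewrite !(dotvBl, dotvBr, dotvZl, dotvZr) (dotvC W Z); ring.
rewrite -/d -/s; nra.
Qed.

(** Pushing [z] towards the point [u], which is close to [y], brings it back
    into a ball about [y] whose radius is twice the distance of [u]; the factor
    two is what makes the displacement proportional to the overshoot. *)
Lemma retract_to_double_ball C y u z (d e : R) :
  convex_combs C -> C u -> C z -> 0 <= e ->
  enorm (u - y) <= d -> enorm (z - y) <= 2 * d + 3 * e ->
  exists z', [/\ C z', enorm (z' - y) <= 2 * d & enorm (z' - z) <= 9 * e].
Proof.
move=> Ccvx Cu Cz e0 uy zy.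
have d0 : 0 <= d by exact: le_trans (enorm_ge0 _) uy.
move: e0; rewrite le_eqVlt => /orP[/eqP e0|e0].
  exists z; split=> //; first by move: zy; rewrite -e0; lra.
  by rewrite subrr enorm0 -e0 mulr0.
have de0 : 0 < d + 3 * e by lra.
(* the fraction for which 2 d + 3 e - a (d + 3 e) = 2 d *)
pose a := 3 * e / (d + 3 * e).
have aE : a * (d + 3 * e) = 3 * e by rewrite /a divfK// gt_eqF.
have a0 : 0 <= a by rewrite divr_ge0//; lra.
have a1 : a <= 1 by rewrite ler_pdivrMr// mul1r; lra.
exists (a *: u + (1 - a) *: z); split; first by apply: Ccvx => //; rewrite a0.
  have -> : a *: u + (1 - a) *: z - y = a *: (u - y) + (1 - a) *: (z - y).
    by apply/rowP => i; rewrite !mxE; ring.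
  rewrite (le_trans (enormD _ _))// !enormZ !ger0_norm ?subr_ge0//.
  have := ler_wpM2l a0 uy.
  have : (1 - a) * enorm (z - y) <= (1 - a) * (2 * d + 3 * e).
    by rewrite ler_wpM2l// subr_ge0.
  lra.
have -> : a *: u + (1 - a) *: z - z = a *: ((u - y) + (y - z)).
  by apply/rowP => i; rewrite !mxE; ring.
rewrite enormZ ger0_norm//.
have h : enorm (u - y + (y - z)) <= 3 * (d + e).
  rewrite (le_trans (enormD _ _))// (enormBC y); lra.
apply: le_trans (ler_wpM2l a0 h) _.
have : a * d + a * e <= a * (d + 3 * e) by nra.
lra.
Qed.

End ConvexSets.

(** * Points of the product of the real line with a Euclidean space *)

Section HeadTail.
Context {R : realType} {n : nat}.
Implicit Types (y z : 'rV[R]_n.+1) (v : 'rV[R]_n) (a b : R).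

Definition hd z : R := z 0 ord0.
Definition tl z : 'rV[R]_n := \row_i z 0 (lift ord0 i).
Definition pt a v : 'rV[R]_n.+1 :=
  \row_i if unlift ord0 i is Some j then v 0 j else a.

Lemma hd_pt a v : hd (pt a v) = a.
Proof. by rewrite /hd mxE unlift_none. Qed.

Lemma tl_pt a v : tl (pt a v) = v.
Proof. by apply/rowP => i; rewrite !mxE liftK. Qed.

Lemma hdD y z : hd (y + z) = hd y + hd z. Proof. by rewrite /hd mxE. Qed.
Lemma hdB y z : hd (y - z) = hd y - hd z. Proof. by rewrite /hd !mxE. Qed.
Lemma hdZ a z : hd (a *: z) = a * hd z. Proof. by rewrite /hd mxE. Qed.
Lemma tlD y z : tl (y + z) = tl y + tl z.
Proof. by apply/rowP => i; rewrite !mxE. Qed.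
Lemma tlB y z : tl (y - z) = tl y - tl z.
Proof. by apply/rowP => i; rewrite !mxE. Qed.
Lemma tlZ a z : tl (a *: z) = a *: tl z.
Proof. by apply/rowP => i; rewrite !mxE. Qed.

Lemma dotv_hd_tl y z : dotv y z = hd y * hd z + dotv (tl y) (tl z).
Proof.
rewrite /dotv big_ord_recl; congr (_ + _).
by apply: eq_bigr => i _; rewrite !mxE.
Qed.

Lemma normr_hd_le z : `|hd z| <= enorm z.
Proof. exact: normr_coord_le_enorm. Qed.

Lemma enorm_tl_le z : enorm (tl z) <= enorm z.
Proof.
rewrite -ler_sqr ?nnegrE ?enorm_ge0// !sqr_enorm (dotv_hd_tl z) lerDr.
by rewrite -expr2 sqr_ge0.
Qed.

Lemma enorm_le_hd_tl z : enorm z <= `|hd z| + enorm (tl z).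
Proof.
have t0 := enorm_ge0 (tl z); have h0 := normr_ge0 (hd z).
rewrite -ler_sqr ?nnegrE ?addr_ge0 ?enorm_ge0// sqr_enorm (dotv_hd_tl z).
rewrite sqrrD sqr_enorm real_normK ?num_real// expr2; nra.
Qed.

Lemma continuous_hd : continuous hd.
Proof. by move=> z; exact: coord_continuous. Qed.

Lemma continuous_tl : continuous tl.
Proof.
move=> z; apply/(cvg_enormP (nbhs_filter z)) => e e0.
apply: filterS (near_enorm_le z e0) => w.
by apply: le_trans; rewrite -tlB enorm_tl_le.
Qed.

End HeadTail.

(** * The epigraph of a conjugate function *)

Section ConjugateEpigraph.
Context {R : realType} {n : nat}.
Implicit Types (H : 'rV[R]_n -> R) (p q v : 'rV[R]_n) (u w y z : 'rV[R]_n.+1).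

Definition convex_lipschitz H (C : R) :=
  [/\ 0 <= C,
      forall p q a, 0 <= a <= 1 ->
        H (a *: p + (1 - a) *: q) <= a * H p + (1 - a) * H q &
      forall p q, `|H p - H q| <= C * enorm (p - q)].

(** The head coordinate is the height, the tail the velocity: this is the
    epigraph of the Legendre-Fenchel conjugate of [H], written as an
    intersection of half-spaces so that no infinite value appears. *)
Definition conj_epi H : set 'rV[R]_n.+1 :=
  [set z | forall p, dotv p (tl z) - hd z <= H p].

Lemma dotv_slope p z : dotv (pt (-1) p) z = dotv p (tl z) - hd z.
Proof. by rewrite dotv_hd_tl hd_pt tl_pt mulN1r addrC. Qed.

Lemma enorm_slope_ge1 p : 1 <= enorm (pt (-1) p).
Proof. by apply: le_trans (normr_hd_le _); rewrite hd_pt normrN normr1. Qed.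

Lemma enorm_slope_ge p : enorm p <= enorm (pt (-1) p).
Proof. by apply: le_trans (enorm_tl_le _); rewrite tl_pt. Qed.

Lemma enorm_slope_gt0 p : 0 < enorm (pt (-1) p).
Proof. exact: lt_le_trans ltr01 (enorm_slope_ge1 p). Qed.

Lemma convex_lipschitz_le H C p : convex_lipschitz H C -> `|H p| <= `|H 0| + C * enorm p.
Proof.
case=> _ _ /(_ p 0); rewrite subr0 => Hp.
rewrite -[H p](subrK (H 0)) addrC; exact: le_trans (ler_normD _ _) (lerD _ _).
Qed.

Lemma convex_lipschitz_continuous H C : convex_lipschitz H C -> continuous H.
Proof.
case=> C0 _ Hlip p; apply/(@cvgrPdist_le _ _ _ _ (nbhs_filter p)) => e e0.
have e'0 : 0 < e / (C + 1) by rewrite divr_gt0//; lra.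
apply: filterS (near_enorm_le p e'0) => q qp.
apply: le_trans (Hlip _ _) _; rewrite enormBC.
apply: (@le_trans _ _ ((C + 1) * enorm (q - p))).
  by rewrite ler_wpM2r ?enorm_ge0//; lra.
by rewrite mulrC -ler_pdivlMr//; lra.
Qed.

Lemma conj_epi_convex H : convex_combs (conj_epi H).
Proof.
move=> u v a Ku Kv /andP[a0 a1] p.
rewrite tlD !tlZ hdD !hdZ dotvDr !dotvZr.
have := ler_wpM2l a0 (Ku p); have := ler_wpM2l (_ : 0 <= 1 - a) (Kv p).
by rewrite subr_ge0 => /(_ a1); lra.
Qed.

Lemma conj_epi_closed H : closed (conj_epi H).
Proof.
have -> : conj_epi H =
    \bigcap_(p in [set: 'rV[R]_n]) [set z | dotv (pt (-1) p) z <= H p].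
  apply/seteqP; split=> z /= Kz p; first by move=> _ /=; rewrite dotv_slope.
  by have := Kz p I; rewrite /= dotv_slope.
apply: closed_bigI => p _.
apply: (@closed_comp _ _ (dotv (pt (-1) p)) [set x | x <= H p]).
  by move=> z _; exact: continuous_dotv.
exact: closed_le.
Qed.

Lemma conj_epi_up H z (a : R) : conj_epi H z -> 0 <= a -> conj_epi H (pt (hd z + a) (tl z)).
Proof. by move=> Kz a0 p; rewrite hd_pt tl_pt; have := Kz p; lra. Qed.

Lemma conj_epi_hd_ge H z : conj_epi H z -> - H 0 <= hd z.
Proof. by move=> /(_ 0); rewrite dotv0l; lra. Qed.

(** [H] is its own biconjugate: the point of height [H p - e] over [p] lies below
    the epigraph of [H], and the vector from its projection is an outer normal
    that points strictly downwards, hence the slope of an affine minorant. *)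
Lemma conj_epi_support H C p (e : R) : convex_lipschitz H C -> 0 < e ->
  exists2 z, conj_epi H z & H p - e < dotv p (tl z) - hd z.
Proof.
move=> HC e0; have [_ Hcvx _] := HC.
pose E := [set z | H (tl z) <= hd z].
have Ecl : closed E.
  have -> : E = (fun z => H (tl z) - hd z) @^-1` [set x | x <= 0].
    by apply/seteqP; split=> z /=; rewrite subr_le0.
  apply: closed_comp; last exact: closed_le.
  move=> z _; apply: continuousB; last exact: continuous_hd.
  apply: continuous_comp; first exact: continuous_tl.
  exact: convex_lipschitz_continuous HC _.
have Egraph q : E (pt (H q) q) by rewrite /E/= hd_pt tl_pt.
have Ecvx : convex_combs E.
  move=> u w a; rewrite /E/= => Eu Ew a01; rewrite tlD !tlZ hdD !hdZ.
  apply: le_trans (Hcvx _ _ _ a01) _; case/andP: a01 => a0 a1.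
  by apply: lerD; apply: ler_wpM2l => //; rewrite subr_ge0.
pose z0 := pt (H p - e) p.
have [u Eu umin] := nearest_point z0 Ecl (ex_intro _ _ (Egraph p)).
have obtuse := nearest_point_obtuse Ecvx Eu umin.
pose N := z0 - u.
have N0 : 0 < dotv N N.
  rewrite lt_def dotvv_ge0 andbT -sqr_enorm expf_eq0/=; apply/negP => /eqP/enorm_eq0.
  move=> /eqP; rewrite subr_eq0 => /eqP z0u; move: Eu; rewrite -z0u /E/= hd_pt tl_pt; lra.
have normal q : hd N * H q + dotv (tl N) q <= dotv N u.
  by have := obtuse _ (Egraph q); rewrite -/N dotvBr dotv_hd_tl hd_pt tl_pt subr_le0.
have zN : dotv N z0 = dotv N N + dotv N u by rewrite -dotvDr subrK.
have z0E : dotv N z0 = hd N * (H p - e) + dotv (tl N) p.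
  by rewrite dotv_hd_tl hd_pt tl_pt.
have hdN : hd N < 0.
  have := normal p; rewrite -(pmulr_llt0 _ e0) mulrC; nra.
pose m := (- hd N)^-1.
have m0 : 0 < m by rewrite invr_gt0 oppr_gt0.
have mE : m * hd N = -1 by rewrite /m invrN mulNr mulVf// lt_eqF.
exists (pt (m * dotv N u) (m *: tl N)).
  move=> q; rewrite hd_pt tl_pt dotvZr (dotvC q).
  have := ler_wpM2l (ltW m0) (normal q); rewrite mulrDr mulrA mE; lra.
rewrite hd_pt tl_pt dotvZr (dotvC p).
have : m * dotv N u < m * dotv N z0 by rewrite ltr_pM2l// zN; lra.
by rewrite z0E mulrDr mulrA mE; lra.
Qed.

Lemma conj_epi_nonempty H C : convex_lipschitz H C -> conj_epi H !=set0.
Proof. by move=> /(conj_epi_support 0)/(_ ltr01)[z Kz _]; exists z. Qed.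

(** The distance to [conj_epi H] is the largest violation of its defining
    inequalities, measured in units of the length of their normals.  The normal
    at the projection of [z] may be horizontal, which is not one of the
    directions [pt (-1) p]; tilting it downwards by a small [e] makes it one. *)
Lemma conj_epi_dist H C z (b : R) : convex_lipschitz H C -> 0 <= b ->
  (forall p, dotv p (tl z) - hd z - H p <= b * enorm (pt (-1) p)) ->
  exists2 u, conj_epi H u & enorm (z - u) <= b.
Proof.
move=> HC b0 gapb.
have [u Ku umin] := nearest_point z (@conj_epi_closed H) (conj_epi_nonempty HC).
have obtuse := nearest_point_obtuse (@conj_epi_convex H) Ku umin.
exists u => //; set d := enorm (z - u).
pose N := z - u; have d0 : 0 <= d := enorm_ge0 _.
have hdN : hd N <= 0.
  have := obtuse _ (conj_epi_up Ku ler01).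
  by rewrite -/N dotvBr !dotv_hd_tl hd_pt tl_pt; lra.
rewrite -ler_sqr ?nnegrE// leNgt; apply/negP => bd.
have {}bd : b < d by rewrite -ltr_sqr ?nnegrE.
pose B := b + hd z + H 0 + 1 + d.
have key (e : R) : 0 < e -> e <= 1 -> d ^+ 2 <= b * d + e * `|B|.
  move=> e0 e1; pose t := e - hd N.
  have t0 : 0 < t by rewrite /t; lra.
  have td : t <= e + d by have := normr_hd_le N; rewrite ler_norml /t => /andP[]; rewrite -/d; lra.
  pose p := t^-1 *: tl N.
  have tp : t *: p = tl N by rewrite /p scalerA mulfV ?scale1r// gt_eqF.
  have tslope : t *: pt (-1) p = N - pt e 0.
    apply/rowP => i; have := congr1 (fun v => v 0) tp.
    case: (unliftP ord0 i) => [j ->|->]; rewrite !mxE ?liftK ?unlift_none => h.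
      have := congr1 (fun f => f j) h; rewrite /= !mxE; lra.
    by rewrite mulrN1 /t/hd !mxE; lra.
  have [w Kw] := conj_epi_support p HC e0.
  rewrite -!dotv_slope => ltw.
  have {}ltw : t * (H p - e) < dotv N w - e * hd w.
    have : t * (H p - e) < t * dotv (pt (-1) p) w by rewrite ltr_pM2l.
    by rewrite -dotvZl tslope dotvBl (dotv_hd_tl (pt _ _)) hd_pt tl_pt dotv0l addr0.
  have := gapb p; rewrite -dotv_slope => gp.
  have {}gp : dotv N z - e * hd z - t * H p <= b * (d + e).
    have := ler_wpM2l (ltW t0) gp; rewrite mulrBr -dotvZl tslope dotvBl.
    rewrite (dotv_hd_tl (pt _ _)) hd_pt tl_pt dotv0l addr0 => /le_trans; apply.
    rewrite mulrCA ler_wpM2l// -(gtr0_norm t0) -enormZ tslope.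
    rewrite (le_trans (enormD _ _))// enormN lerD2l.
    by rewrite (le_trans (enorm_le_hd_tl _))// hd_pt tl_pt enorm0 addr0 gtr0_norm.
  have hw := conj_epi_hd_ge Kw.
  have Nwu : dotv N w <= dotv N u by rewrite -subr_le0 -dotvBr; exact: obtuse.
  have dE : d ^+ 2 = dotv N z - dotv N u by rewrite sqr_enorm -dotvBr.
  have : e * B <= e * `|B| by rewrite ler_wpM2l ?ler_norm// ltW.
  rewrite dE; have : e * - H 0 <= e * hd w by rewrite ler_wpM2l// ltW.
  have : t * e <= (e + d) * e by rewrite ler_wpM2r// ltW.
  have : e * e <= e by rewrite ger_pMr.
  by rewrite /B; lra.
pose e0 := d * (d - b) / (2 * (`|B| + d * (d - b) + 1)).
have db0 : 0 < d * (d - b) by rewrite mulr_gt0 ?subr_gt0//; lra.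
have BB : 0 <= `|B| := normr_ge0 _.
have den : 0 < 2 * (`|B| + d * (d - b) + 1) by lra.
have e0E : e0 * (2 * (`|B| + d * (d - b) + 1)) = d * (d - b) by rewrite divfK// gt_eqF.
have e00 : 0 < e0 by rewrite divr_gt0.
have e01 : e0 <= 1 by rewrite ler_pdivrMr// mul1r; lra.
have := key _ e00 e01; nra.
Qed.

End ConjugateEpigraph.

(** * A Lipschitz selection of convex bodies: the mean subgradient over a cube *)

Section SignAverage.
Context {R : realType} {n : nat}.
Implicit Types (p q v : 'rV[R]_n) (s : seq 'rV[R]_n) (g h : 'rV[R]_n -> R).

(** The mean of [g (p + sum of the +- v, v in s)] over all choices of signs. *)
Definition sign_avg s g : 'rV[R]_n -> R :=
  foldr (fun v g p => (g (p + v) + g (p - v)) / 2) g s.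

Lemma sign_avg_cat s1 s2 g : sign_avg (s1 ++ s2) g = sign_avg s1 (sign_avg s2 g).
Proof. exact: foldr_cat. Qed.

Lemma sign_avg_swap s1 s2 g : sign_avg s1 (sign_avg s2 g) = sign_avg s2 (sign_avg s1 g).
Proof.
have swap1 v s g' : sign_avg [:: v] (sign_avg s g') = sign_avg s (sign_avg [:: v] g').
  elim: s => //= w s <-; apply/funext => p /=.
  rewrite (addrAC p v w) (addrAC p v (- w)) (addrAC p (- v) w) (addrAC p (- v) (- w)).
  by rewrite -!mulrDl; congr (_ / _ / _); rewrite addrACA.
elim: s1 => //= v s IH; rewrite -/(sign_avg [:: v] _) IH.
exact: swap1.
Qed.

Lemma sign_avg_perm s1 s2 g : perm_eq s1 s2 -> sign_avg s1 g = sign_avg s2 g.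
Proof.
apply: (@catCA_perm_subst _ _ (fun s => sign_avg s g)) => {}s1 {}s2 s.
by rewrite !sign_avg_cat sign_avg_swap.
Qed.

Lemma sign_avg_shift s g v p : sign_avg s g (p + v) = sign_avg s (fun q => g (q + v)) p.
Proof.
by elim: s g p => //= w s IH g p; rewrite -!IH; congr ((sign_avg _ _ _ + sign_avg _ _ _) / 2);
  rewrite addrAC.
Qed.

Lemma sign_avg_le_box s g h p (c : R) :
  (forall q, (forall i, `|q 0 i - p 0 i| <= \sum_(v <- s) `|v 0 i|) -> g q <= h q + c) ->
  sign_avg s g p <= sign_avg s h p + c.
Proof.
elim: s p => [|v s IH] p gh /=; first by apply: gh => i; rewrite subrr normr0 big_nil.
have box q (w : 'rV[R]_n) : (forall i, `|w 0 i| = `|v 0 i|) ->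
    (forall i, `|q 0 i - (p + w) 0 i| <= \sum_(v <- s) `|v 0 i|) -> g q <= h q + c.
  move=> wv qw; apply: gh => i; rewrite big_cons.
  have -> : q 0 i - p 0 i = w 0 i + (q 0 i - (p + w) 0 i) by rewrite !mxE; ring.
  by rewrite (le_trans (ler_normD _ _))// lerD ?wv.
have h1 := IH (p + v) (fun q => box q v (fun=> erefl)).
have h2 : sign_avg s g (p - v) <= sign_avg s h (p - v) + c.
  by apply: IH => q; apply: (box q (- v)) => i; rewrite mxE normrN.
lra.
Qed.

Lemma sign_avg_le s g h p (c : R) : (forall q, g q <= h q + c) ->
  sign_avg s g p <= sign_avg s h p + c.
Proof. by move=> gh; apply: sign_avg_le_box => q _. Qed.

Lemma sign_avg_dist s g h p (c : R) : (forall q, `|g q - h q| <= c) ->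
  `|sign_avg s g p - sign_avg s h p| <= c.
Proof.
move=> gh; rewrite ler_distlC lerBlDr; apply/andP; split; apply: sign_avg_le => q;
  have := gh q; rewrite ler_norml; lra.
Qed.

Lemma sign_avg_near s g p (L : R) : 0 <= L ->
  (forall q v, `|g (q + v) - g q| <= L * enorm v) ->
  `|sign_avg s g p - g p| <= L * \sum_(v <- s) enorm v.
Proof.
move=> L0 glip; elim: s p => [|v s IH] p /=.
  by rewrite subrr normr0 big_nil mulr0.
rewrite big_cons mulrDr.
have := IH (p + v); have := IH (p - v); have := glip p v; have := glip p (- v).
by rewrite enormN !ler_norml; lra.
Qed.

Lemma sign_avg_convex s (xi : 'rV[R]_n -> 'rV[R]_n) C p : convex_combs C ->
  (forall q, C (xi q)) -> C (\row_i sign_avg s (fun q => xi q 0 i) p).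
Proof.
move=> Ccvx Cxi; elim: s p => [|v s IH] p /=.
  by have -> : \row_i xi p 0 i = xi p by apply/rowP => i; rewrite mxE.
have -> : (\row_i ((sign_avg s (fun q => xi q 0 i) (p + v) +
      sign_avg s (fun q => xi q 0 i) (p - v)) / 2)) =
    2^-1 *: (\row_i sign_avg s (fun q => xi q 0 i) (p + v)) +
    (1 - 2^-1) *: (\row_i sign_avg s (fun q => xi q 0 i) (p - v)).
  by apply/rowP => i; rewrite !mxE; lra.
by apply: Ccvx => //; lra.
Qed.

End SignAverage.

Section CubeMean.
Context {R : realType} {n : nat}.
Implicit Types (p q v : 'rV[R]_n) (g h : 'rV[R]_n -> R) (i j : 'I_n) (J : seq 'I_n).

Local Notation e i := (delta_mx 0 i : 'rV[R]_n).

(** Sums of [+- 2^-l *: e j] over [j] in [J] and [1 <= l <= k] form a uniform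
    grid in the cube spanned by the directions in [J]. *)
Definition grid_steps J k : seq 'rV[R]_n :=
  flatten [seq [seq 2^-1 ^+ l.+1 *: e j | j <- J] | l <- iota 0 k].

Lemma grid_stepsS J k :
  grid_steps J k.+1 = grid_steps J k ++ [seq 2^-1 ^+ k.+1 *: e j | j <- J].
Proof. by rewrite /grid_steps -(addn1 k) iotaD map_cat flatten_cat/= cats0 add0n addn1. Qed.

Lemma perm_grid_steps_cat J1 J2 k :
  perm_eq (grid_steps (J1 ++ J2) k) (grid_steps J1 k ++ grid_steps J2 k).
Proof.
elim: k => // k IH; rewrite !grid_stepsS map_cat.
by rewrite perm_sym perm_catACA perm_sym perm_cat.
Qed.

Lemma perm_grid_steps J1 J2 k : perm_eq J1 J2 ->
  perm_eq (grid_steps J1 k) (grid_steps J2 k).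
Proof.
by move=> J12; elim: k => // k IH; rewrite !grid_stepsS perm_cat// perm_map.
Qed.

Lemma sum_grid_steps J k j : uniq J ->
  \sum_(v <- grid_steps J k) `|v 0 j| = (1 - 2^-1 ^+ k) * (j \in J)%:R.
Proof.
move=> uJ; elim: k => [|k IH]; first by rewrite big_nil expr0 subrr mul0r.
rewrite grid_stepsS big_cat/= IH big_map.
have -> : \sum_(i <- J) `|(2^-1 ^+ k.+1 *: e i) 0 j| = 2^-1 ^+ k.+1 * (j \in J)%:R :> R.
  rewrite -(@count_uniq_mem _ _ j uJ) -sum1_count natr_sum mulr_sumr [RHS]big_mkcond.
  apply: eq_bigr => i _; rewrite !mxE eqxx/= (eq_sym j i).
  by case: eqP; rewrite ?mulr1 ?mulr0 ?normr0// ger0_norm// exprn_ge0.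
by rewrite exprS; lra.
Qed.

Definition cdiff v g p := (g (p + v) - g (p - v)) / 2.

(** Averaging a difference quotient of step [2^-k] over the dyadic grid in its own
    direction telescopes to the difference quotient of step [1]. *)
Lemma sign_avg_cdiff i k g :
  sign_avg (grid_steps [:: i] k)
    (fun p => cdiff (2^-1 ^+ k *: e i) g p / 2^-1 ^+ k) = cdiff (e i) g.
Proof.
elim: k => [|k IH]; first by apply/funext => p; rewrite /= expr0 scale1r divr1.
rewrite grid_stepsS sign_avg_cat/= -[RHS]IH; congr sign_avg; apply/funext => p.
rewrite /cdiff; set a := 2^-1 ^+ k.+1.
have a0 : a != 0 by rewrite expf_neq0.
have -> : 2^-1 ^+ k = 2 * a by rewrite /a exprS mulrA mulfV// mul1r.
have -> : (2 * a) *: e i = a *: e i + a *: e i by rewrite -scalerDl -mulr2n mulr_natl.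
by rewrite opprD !addrA addrK subrK; field; rewrite a0.
Qed.

Definition other_axes i := [seq j <- enum 'I_n | j != i].

Lemma perm_other_axes i : perm_eq (enum 'I_n) (other_axes i ++ [:: i]).
Proof.
rewrite perm_sym perm_catC perm_sym /other_axes.
rewrite (_ : [seq j <- enum 'I_n | j != i] = rem i (enum 'I_n)).
  by apply: perm_to_rem; rewrite mem_enum.
by rewrite rem_filter ?enum_uniq.
Qed.

Definition grid_mean g k i : R :=
  sign_avg (grid_steps (other_axes i) k) (cdiff (e i) g) 0.

(** Formally the mean of the gradient of [g] over the cube of side 2: by
    the fundamental theorem of calculus the integral in the direction [i] has been
    carried out, so that no derivative is left. *)
Definition cube_mean g : 'rV[R]_n := \row_i limn (fun k => grid_mean g k i).

Section Lipschitz.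
Variables (g : 'rV[R]_n -> R) (L : R).
Hypotheses (L0 : 0 <= L) (glip : forall p q, `|g p - g q| <= L * enorm (p - q)).

Lemma cdiff_lipschitz v p q : `|cdiff v g (p + q) - cdiff v g p| <= L * enorm q.
Proof.
have := glip (p + q + v) (p + v); have := glip (p + q - v) (p - v).
have -> : p + q - v - (p - v) = q by apply/rowP => i; rewrite !mxE; ring.
have -> : p + q + v - (p + v) = q by apply/rowP => i; rewrite !mxE; ring.
by rewrite /cdiff !ler_norml; lra.
Qed.

Lemma enorm_axis i (a : R) : enorm (a *: e i) = `|a|.
Proof.
rewrite enormZ /enorm /dotv (bigD1 i)//= big1 => [|j ji].
  by rewrite !mxE !eqxx mul1r addr0 sqrtr1 mulr1.
by rewrite !mxE (negbTE ji) mul0r.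
Qed.

Lemma grid_mean_step i k :
  `|grid_mean g k.+1 i - grid_mean g k i| <= L * n%:R * 2^-1 ^+ k.+1.
Proof.
rewrite /grid_mean grid_stepsS sign_avg_cat; apply: sign_avg_dist => q.
apply: le_trans (sign_avg_near _ _ L0 (cdiff_lipschitz _)) _.
rewrite -mulrA ler_wpM2l// big_map.
under eq_bigr do rewrite enorm_axis ger0_norm ?exprn_ge0//.
rewrite big_const_seq count_predT iter_addr_0 -[leLHS]mulr_natl ler_wpM2r ?exprn_ge0//.
rewrite ler_nat -[leqRHS](size_enum_ord n); exact: size_subseq (filter_subseq _ _).
Qed.

Lemma cvg_grid_mean i : cvgn (fun k => grid_mean g k i).
Proof.
set u := fun k => grid_mean g k i; set B := L * n%:R.
have B0 : 0 <= B by rewrite mulr_ge0.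
have ustep k : `|u k.+1 - u k| <= B * 2^-1 ^+ k.+1 := grid_mean_step i k.
have hB k : B * 2^-1 ^+ k = 2 * (B * 2^-1 ^+ k.+1).
  by rewrite exprS; lra.
(* correcting u by the sum of its possible later increments makes it monotone *)
have a_mono : nonincreasing_seq (fun k => u k + B * 2^-1 ^+ k).
  apply/nonincreasing_seqP => k; have := ustep k; have := hB k.
  by rewrite ler_norml; lra.
have b_mono : nondecreasing_seq (fun k => u k - B * 2^-1 ^+ k).
  apply/nondecreasing_seqP => k; have := ustep k; have := hB k.
  by rewrite ler_norml; lra.
have a_cvg : cvgn (fun k => u k + B * 2^-1 ^+ k).
  apply: nonincreasing_is_cvgn => //; exists (u 0%N - B) => _ [k _ <-].
  have := b_mono 0%N k (leq0n k); rewrite expr0 mulr1.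
  have : 0 <= B * 2^-1 ^+ k by rewrite mulr_ge0// exprn_ge0.
  lra.
have p_cvg : cvgn (fun k => B * 2^-1 ^+ k : R).
  by apply: is_cvgMr; apply/cvg_ex; exists 0; apply: cvg_expr; rewrite ger0_norm//; lra.
have -> : u = (fun k => (u k + B * 2^-1 ^+ k) - B * 2^-1 ^+ k).
  by apply/funext => k; rewrite addrK.
exact: is_cvgB.
Qed.

Lemma cube_mean_cvg i : (fun k => grid_mean g k i) @ \oo --> cube_mean g 0 i.
Proof. by rewrite mxE; exact: cvg_grid_mean. Qed.

End Lipschitz.

(** If [g] is the support function of [C], its mean gradient is a limit of
    averages of points of [C], namely of the points where the maximum defining [g]
    is attained. *)
Lemma cube_mean_in C g (L : R) : closed C -> convex_combs C ->
  (forall z, C z -> enorm z <= L) ->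
  (forall p, exists2 z, C z & g p = dotv p z) ->
  (forall p z, C z -> dotv p z <= g p) ->
  C (cube_mean g).
Proof.
move=> Ccl Ccvx CL gatt gmax.
have L0 : 0 <= L by have [z /CL + _] := gatt 0; exact: le_trans (enorm_ge0 _).
have glip p q : `|g p - g q| <= L * enorm (p - q).
  have half p' q' : g p' - g q' <= L * enorm (p' - q').
    have [z Cz ->] := gatt p'; have := gmax q' z Cz.
    have := cauchy_schwarz (p' - q') z; rewrite dotvBl.
    have : enorm (p' - q') * enorm z <= enorm (p' - q') * L.
      by rewrite ler_wpM2l ?enorm_ge0 ?CL.
    lra.
  have := half p q; have := half q p; rewrite (enormBC q p) ler_norml; lra.
have gatt' p : exists z, C z /\ g p = dotv p z by have [z] := gatt p; exists z.
have [xi /all_and2[Cxi gxi]] := choice gatt'.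
pose x k := \row_i sign_avg (grid_steps (enum 'I_n) k) (fun q => xi q 0 i) 0.
have Cx k : C (x k) by exact: sign_avg_convex.
have dote i z : dotv (e i) z = z 0 i.
  rewrite /dotv (bigD1 i)//= big1 => [|j ji]; first by rewrite mxE !eqxx mul1r addr0.
  by rewrite mxE (negbTE ji) mul0r.
have xmean k i : `|x k 0 i - grid_mean g k i| <= L * 2^-1 ^+ k.
  set r := 2^-1 ^+ k; have r0 : 0 < r by rewrite exprn_gt0.
  pose D p := cdiff (r *: e i) g p / r.
  have Davg p : sign_avg (grid_steps (enum 'I_n) k) D p =
      sign_avg (grid_steps (other_axes i) k) (cdiff (e i) g) p.
    rewrite (@sign_avg_perm _ _ _ (grid_steps (other_axes i) k ++ grid_steps [:: i] k)).
      by rewrite sign_avg_cat sign_avg_cdiff.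
    apply: (perm_trans (perm_grid_steps k (perm_other_axes i))).
    exact: perm_grid_steps_cat.
  have xiD q (a : R) : `|a| = 1 -> a * xi q 0 i <= a * D (q + (a * r) *: e i).
    (* a one-sided difference quotient of a convex function is monotone *)
    move=> a1; have aa : a * a = 1 by rewrite -expr2 -real_normK ?num_real// a1 expr1n.
    have := gmax (q + (2 * a * r) *: e i) _ (Cxi q).
    rewrite dotvDl -gxi dotvZl dote => h.
    rewrite /D /cdiff -(ler_pM2l (_ : 0 < 2 * r)); last by lra.
    have : `|a| == 1 by rewrite a1.
    rewrite eqr_norml ler01 andbT => /orP[] /eqP aE; subst a.
      have -> : q + (1 * r) *: e i + r *: e i = q + (2 * 1 * r) *: e i.
        by apply/rowP => j; rewrite !mxE; ring.
      have -> : q + (1 * r) *: e i - r *: e i = q.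
        by apply/rowP => j; rewrite !mxE; ring.
      have -> : 2 * r * (1 * ((g (q + (2 * 1 * r) *: e i) - g q) / 2 / r)) =
        g (q + (2 * 1 * r) *: e i) - g q by field; rewrite gt_eqF.
      lra.
    have -> : q + (-1 * r) *: e i - r *: e i = q + (2 * -1 * r) *: e i.
      by apply/rowP => j; rewrite !mxE; ring.
    have -> : q + (-1 * r) *: e i + r *: e i = q.
      by apply/rowP => j; rewrite !mxE; ring.
    have -> : 2 * r * (-1 * ((g q - g (q + (2 * -1 * r) *: e i)) / 2 / r)) =
      g (q + (2 * -1 * r) *: e i) - g q by field; rewrite gt_eqF.
    lra.
  have Dnear (a : R) : `|a| = 1 ->
      `|sign_avg (grid_steps (enum 'I_n) k) (fun q => D (q + (a * r) *: e i)) 0 -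
        grid_mean g k i| <= L * r.
    move=> a1; rewrite -sign_avg_shift Davg sign_avg_shift; apply: sign_avg_dist => q.
    apply: le_trans (cdiff_lipschitz glip _ _ _) _.
    by rewrite enorm_axis normrM a1 mul1r gtr0_norm.
  rewrite mxE.
  have := Dnear 1 (normr1 _); have := Dnear (-1) (etrans (normrN _) (normr1 _)).
  have up : sign_avg (grid_steps (enum 'I_n) k) (fun q => xi q 0 i) 0 <=
      sign_avg (grid_steps (enum 'I_n) k) (fun q => D (q + (1 * r) *: e i)) 0 + 0.
    by apply: sign_avg_le => q; have := xiD q 1 (normr1 _); rewrite !mul1r addr0.
  have lo : sign_avg (grid_steps (enum 'I_n) k) (fun q => D (q + (-1 * r) *: e i)) 0 <=
      sign_avg (grid_steps (enum 'I_n) k) (fun q => xi q 0 i) 0 + 0.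
    apply: sign_avg_le => q; have := xiD q (-1) (etrans (normrN _) (normr1 _)).
    by rewrite !mulN1r addr0 lerN2.
  rewrite !ler_norml; lra.
have r_cvg : (fun k => L * 2^-1 ^+ k : R) @ \oo --> 0.
  rewrite -(mulr0 L); apply: cvgM; first exact: cvg_cst.
  by apply: cvg_expr; rewrite ger0_norm//; lra.
apply: (@closed_cvg _ _ \oo _ x) => //; first exact: nearW.
apply/(cvg_enormP _) => eps eps0.
have coord i : (fun k => x k 0 i) @ \oo --> cube_mean g 0 i.
  have -> : (fun k => x k 0 i) = (fun k => (x k 0 i - grid_mean g k i) + grid_mean g k i).
    by apply/funext => k; rewrite subrK.
  rewrite -[X in _ --> X]add0r; apply: cvgD; last exact: cube_mean_cvg L0 glip i.
  apply/norm_cvg0P; apply: (squeeze_cvgr _ (cvg_cst 0) r_cvg).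
  by apply: nearW => k; rewrite normr_ge0 xmean.
have e'0 : 0 < eps / n.+1%:R by rewrite divr_gt0.
have : \forall k \near \oo, forall i, `|cube_mean g 0 i - x k 0 i| <= eps / n.+1%:R.
  apply: filter_forall => i; have /cvgrPdist_le := coord i; exact.
apply: filterS => k xk; apply: le_trans (enorm_le_sum _) _.
apply: (@le_trans _ _ (\sum_(i < n) (eps / n.+1%:R))).
  apply: ler_sum => i _.
  have -> : (x k - cube_mean g) 0 i = x k 0 i - cube_mean g 0 i.
    by rewrite [LHS]mxE [X in _ + X]mxE.
  by rewrite distrC.
rewrite sumr_const card_ord -[leLHS]mulr_natl mulrCA ler_piMr ?(ltW eps0)//.
by rewrite ler_pdivrMr// mul1r ler_nat.
Qed.

(** The point is determined by finite differences of [g], which is why it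
    is Lipschitz in [g] although the subgradients of [g] are not.  The constant is
    [sqrt n * sqrt n]: one factor is the length of a corner of the cube, the other
    the number of coordinates. *)
Lemma cube_mean_lipschitz g g' (L L' r : R) : 0 <= L -> 0 <= L' -> 0 <= r ->
  (forall p q, `|g p - g q| <= L * enorm (p - q)) ->
  (forall p q, `|g' p - g' q| <= L' * enorm (p - q)) ->
  (forall p, `|g p - g' p| <= r * enorm p) ->
  enorm (cube_mean g - cube_mean g') <= n%:R * r.
Proof.
move=> L0 L'0 r0 glip g'lip gg'.
have grid h h' i k : (forall p, `|h p - h' p| <= r * enorm p) ->
    grid_mean h k i <= grid_mean h' k i + r * Num.sqrt n%:R.
  move=> hh'; apply: sign_avg_le_box => q qbox.
  have corner (a : R) : `|a| = 1 -> `|h (q + a *: e i) - h' (q + a *: e i)| <= r * Num.sqrt n%:R.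
    move=> a1; apply: le_trans (hh' _) _; rewrite ler_wpM2l//.
    rewrite -[leRHS]mulr1; apply: enorm_le_coord => // j.
    have := qbox j; rewrite mxE subr0 sum_grid_steps; last first.
      by rewrite filter_uniq// enum_uniq.
    rewrite mem_filter mem_enum andbT !mxE eqxx/=.
    have [->/=|/= ji] := eqVneq j i.
      by rewrite mulr0 normr_le0 => /eqP ->; rewrite add0r mulr1 a1.
    rewrite mulr0 addr0 mulr1 => /le_trans; apply.
    by rewrite gerBl exprn_ge0.
  have := corner 1 (normr1 _); have := corner (-1) (etrans (normrN _) (normr1 _)).
  by rewrite !scale1r scaleN1r /cdiff !ler_norml; lra.
have nE : n%:R * r = Num.sqrt n%:R * (r * Num.sqrt n%:R) :> R.
  by rewrite mulrCA -expr2 sqr_sqrtr ?ler0n// mulrC.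
rewrite nE; apply: enorm_le_coord => [|i]; first by rewrite mulr_ge0// sqrtr_ge0.
have cg := @cube_mean_cvg _ _ L0 glip i; have cg' := @cube_mean_cvg _ _ L'0 g'lip i.
have cd : (fun k => `|grid_mean g k i - grid_mean g' k i|) @ \oo -->
    `|cube_mean g 0 i - cube_mean g' 0 i| by apply: cvg_norm; exact: cvgB cg cg'.
have -> : (cube_mean g - cube_mean g') 0 i = cube_mean g 0 i - cube_mean g' 0 i.
  by rewrite [LHS]mxE [X in _ + X]mxE.
rewrite -(cvg_lim (@Rhausdorff R) cd).
apply: limr_le; first exact: cvgP cd.
apply: nearW => k /=; rewrite ler_norml.
have g'g p : `|g' p - g p| <= r * enorm p by rewrite distrC.
have := grid g g' i k gg'; have := grid g' g i k g'g.
lra.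
Qed.

End CubeMean.

(** * Selecting a point of the epigraph near a given point *)

Section Selection.
Context {R : realType} {n : nat}.
Implicit Types (H : 'rV[R]_n -> R) (p q v : 'rV[R]_n) (u w y z : 'rV[R]_n.+1).
Implicit Types (C r rho : R).

(** By [conj_epi_dist], the Euclidean distance from [z] to the epigraph.  As
    a supremum of explicit functions of [H] it is measurable whenever [H] is. *)
Definition epi_dist H z : R :=
  sup [set Num.max 0 ((dotv p (tl z) - hd z - H p) / enorm (pt (-1) p)) | p in [set: 'rV[R]_n]].

Lemma violation_le H C z p : convex_lipschitz H C ->
  dotv p (tl z) - hd z - H p <= (enorm z + `|H 0| + C) * enorm (pt (-1) p).
Proof.
move=> HC; have [C0 _ _] := HC; rewrite -dotv_slope.
have := cauchy_schwarz (pt (-1) p) z; have := convex_lipschitz_le p HC.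
have := ler_wpM2l C0 (enorm_slope_ge p).
have := ler_wpM2l (normr_ge0 (H 0)) (enorm_slope_ge1 p).
have := lerNnormlW (lexx `|H p|); lra.
Qed.

Lemma has_sup_violation H C z : convex_lipschitz H C ->
  has_sup [set Num.max 0 ((dotv p (tl z) - hd z - H p) / enorm (pt (-1) p)) |
           p in [set: 'rV[R]_n]].
Proof.
move=> HC; have [C0 _ _] := HC; split; first by apply: image_nonempty; exists 0.
exists (enorm z + `|H 0| + C) => _ [p _ <-].
rewrite ge_max ler_pdivrMr ?enorm_slope_gt0// violation_le// andbT.
by rewrite !addr_ge0// enorm_ge0.
Qed.

Lemma violation_le_epi_dist H C z p : convex_lipschitz H C ->
  dotv p (tl z) - hd z - H p <= epi_dist H z * enorm (pt (-1) p).
Proof.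
move=> HC; rewrite -ler_pdivrMr ?enorm_slope_gt0//.
apply: (@le_trans _ _ (Num.max 0 ((dotv p (tl z) - hd z - H p) / enorm (pt (-1) p)))).
  by rewrite le_max lexx orbT.
by apply: sup_ubound; [exact: (has_sup_violation z HC).2|exists p].
Qed.

Lemma epi_dist_ge0 H C z : convex_lipschitz H C -> 0 <= epi_dist H z.
Proof.
move=> HC.
apply: (@le_trans _ _ (Num.max 0 ((dotv (0 : 'rV[R]_n) (tl z) - hd z - H 0) /
  enorm (pt (-1) (0 : 'rV[R]_n))))).
  by rewrite le_max lexx.
by apply: sup_ubound; [exact: (has_sup_violation z HC).2|exists 0].
Qed.

Lemma epi_dist_le H C z (b : R) : convex_lipschitz H C -> 0 <= b ->
  (forall p, dotv p (tl z) - hd z - H p <= b * enorm (pt (-1) p)) -> epi_dist H z <= b.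
Proof.
move=> HC b0 gapb; apply: ge_sup; first exact: (has_sup_violation z HC).1.
by move=> _ [p _ <-]; rewrite ge_max b0 ler_pdivrMr ?enorm_slope_gt0//=.
Qed.

Lemma epi_dist_le_enorm H C z w : convex_lipschitz H C -> conj_epi H w ->
  epi_dist H z <= enorm (z - w).
Proof.
move=> HC Kw; apply: (epi_dist_le HC (enorm_ge0 _)) => p.
have := cauchy_schwarz (pt (-1) p) (z - w); rewrite dotvBr !dotv_slope.
have := Kw p; lra.
Qed.

Lemma epi_dist_attained H C z : convex_lipschitz H C ->
  exists2 u, conj_epi H u & enorm (z - u) <= epi_dist H z.
Proof.
move=> HC; apply: (conj_epi_dist HC (epi_dist_ge0 z HC)) => p.
exact: violation_le_epi_dist HC.
Qed.

Lemma epi_dist_lipschitz H C y z : convex_lipschitz H C ->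
  epi_dist H z <= epi_dist H y + enorm (z - y).
Proof.
move=> HC; have [u Ku yu] := epi_dist_attained y HC.
apply: le_trans (epi_dist_le_enorm z HC Ku) _.
by rewrite (le_trans (enorm_triangle _ y _))// addrC lerD2r.
Qed.

Lemma epi_dist_bound H C z : convex_lipschitz H C ->
  epi_dist H z <= enorm z + `|H 0| + C.
Proof.
move=> HC; have [C0 _ _] := HC; apply: (epi_dist_le HC).
  by rewrite !addr_ge0// enorm_ge0.
by move=> p; exact: violation_le.
Qed.

Lemma epi_dist_mem H C z : convex_lipschitz H C -> conj_epi H z -> epi_dist H z = 0.
Proof.
move=> HC Kz; apply/eqP; rewrite eq_le (epi_dist_ge0 _ HC) andbT.
by have := epi_dist_le_enorm z HC Kz; rewrite subrr enorm0.
Qed.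

(** The nearest point of a convex set is not a Lipschitz function of the set.
    The whole portion of the set within twice the distance is. *)
Definition near_set H y : set 'rV[R]_n.+1 :=
  conj_epi H `&` [set z | enorm (z - y) <= 2 * epi_dist H y].

Lemma near_set_enorm H y z : near_set H y z -> enorm z <= enorm y + 2 * epi_dist H y.
Proof.
by case=> _ /= zy; rewrite -[z](subrK y) (le_trans (enormD _ _))// addrC lerD2l.
Qed.

Lemma near_set_closed H y : closed (near_set H y).
Proof.
apply: closedI; first exact: conj_epi_closed.
apply: (@closed_comp _ _ (fun z => enorm (z - y)) [set x | x <= 2 * epi_dist H y]).
  by move=> z _; exact: continuous_enormB.
exact: closed_le.
Qed.

Lemma near_set_convex H y : convex_combs (near_set H y).
Proof.
move=> u w a [Ku uy] [Kw wy] a01; split; first exact: conj_epi_convex.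
rewrite /=; have -> : a *: u + (1 - a) *: w - y = a *: (u - y) + (1 - a) *: (w - y).
  by apply/rowP => i; rewrite !mxE; ring.
case/andP: a01 => a0 a1; rewrite (le_trans (enormD _ _))// !enormZ !ger0_norm ?subr_ge0//.
have := ler_wpM2l a0 uy; have := ler_wpM2l (_ : 0 <= 1 - a) wy.
by rewrite subr_ge0 => /(_ a1); lra.
Qed.

Lemma near_set_nonempty H C y : convex_lipschitz H C -> near_set H y !=set0.
Proof.
move=> HC; have [u Ku yu] := epi_dist_attained y HC; exists u; split=> //=.
by have := epi_dist_ge0 y HC; rewrite enormBC; lra.
Qed.

Lemma near_set_mem H C y z : convex_lipschitz H C -> conj_epi H y ->
  near_set H y z -> z = y.
Proof.
move=> HC Ky [_ /=]; rewrite (epi_dist_mem HC Ky) mulr0 => zy.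
apply/eqP; rewrite -subr_eq0; apply/eqP/enorm_eq0/eqP.
by rewrite eq_le zy enorm_ge0.
Qed.

(** The constant 4 is 1 for reaching the epigraph and 3 for returning to the
    ball, since the overshoot is at most the displacement plus the excess. *)
Lemma near_set_approx H C y z : convex_lipschitz H C ->
  exists2 z', near_set H y z' &
    enorm (z - z') <= 4 * (epi_dist H z + Num.max 0 (enorm (z - y) - 2 * epi_dist H y)).
Proof.
move=> HC; have [u Ku yu] := epi_dist_attained y HC.
have [w Kw zw] := epi_dist_attained z HC.
set b := Num.max _ _; set d := epi_dist H z in zw *.
have d0 : 0 <= d := epi_dist_ge0 z HC.
have b0 : 0 <= b by rewrite le_max lexx.
have zb : enorm (z - y) - 2 * epi_dist H y <= b by rewrite le_max lexx orbT.
have wy := enorm_triangle w z y.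
rewrite enormBC in yu.
have [||z' [Kz' z'y z'w]] := @retract_to_double_ball _ _ _ y u w _ ((d + b) / 3)
    (@conj_epi_convex _ _ H) Ku Kw _ yu.
- lra.
- by rewrite (enormBC w z) in wy; lra.
exists z' => //; have := enorm_triangle z w z'; rewrite (enormBC w z'); lra.
Qed.

(** One half of a bound on the Hausdorff distance, restricted to a ball because
    locally uniform convergence of [H] controls only bounded parts of epigraphs. *)
Definition excess_le rho r (K K' : set 'rV[R]_n.+1) := forall z, K z -> enorm z <= rho ->
  exists2 z', K' z' & enorm (z - z') <= r.

(** A point of the first set is moved into the other epigraph, at the cost of
    one excess, and then into the other ball, at the cost of nine. *)
Lemma near_set_lipschitz H H' C C' y y' rho r :
  convex_lipschitz H C -> convex_lipschitz H' C' -> 0 <= r ->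
  excess_le rho r (conj_epi H) (conj_epi H') ->
  excess_le rho r (conj_epi H') (conj_epi H) ->
  enorm y + 2 * epi_dist H y <= rho -> enorm y' + epi_dist H' y' <= rho ->
  forall z, near_set H y z -> exists2 z', near_set H' y' z' &
    enorm (z - z') <= 10 * (r + enorm (y - y')).
Proof.
move=> HC HC' r0 KK' K'K yrho y'rho z Pz; have [Kz /= zy] := Pz.
have [w K'w zw] := KK' _ Kz (le_trans (near_set_enorm Pz) yrho).
have [u' K'u' y'u'] := epi_dist_attained y' HC'.
have u'rho : enorm u' <= rho.
  rewrite (le_trans _ y'rho)// -[u'](subrK y') (le_trans (enormD _ _))//.
  by rewrite addrC lerD2l enormBC.
have [u Ku u'u] := K'K _ K'u' u'rho.
have dist_yy' : epi_dist H y <= epi_dist H' y' + r + enorm (y - y').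
  have := epi_dist_le_enorm y HC Ku; have := enorm_triangle y y' u.
  have := enorm_triangle y' u' u; lra.
have wy' : enorm (w - y') <= 2 * epi_dist H' y' + 3 * (r + enorm (y - y')).
  have := enorm_triangle w z y'; have := enorm_triangle z y y'.
  by rewrite (enormBC w z); lra.
rewrite enormBC in y'u'.
have e0 : 0 <= r + enorm (y - y') by rewrite addr_ge0// enorm_ge0.
have [z' [K'z' z'y' z'w]] := retract_to_double_ball (@conj_epi_convex _ _ H') K'u' K'w e0 y'u' wy'.
exists z' => //; have := enorm_triangle z w z'; rewrite (enormBC w z').
have := enorm_ge0 (y - y'); lra.
Qed.

Definition supp (K : set 'rV[R]_n.+1) (p : 'rV[R]_n.+1) : R := sup [set dotv p z | z in K].

Definition selection H y : 'rV[R]_n.+1 := cube_mean (supp (near_set H y)).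

Lemma supp_near_set_attained H C y (p : 'rV[R]_n.+1) : convex_lipschitz H C ->
  exists2 z, near_set H y z & supp (near_set H y) p = dotv p z.
Proof.
move=> HC; have Pcpt : compact (near_set H y).
  apply: bounded_closed_compact; last exact: near_set_closed.
  exact: (@bounded_set_enorm _ _ _ (enorm y + 2 * epi_dist H y) (@near_set_enorm H y)).
have [z + zmax] := EVT_max_rV (near_set_nonempty y HC) Pcpt
  (continuous_subspaceT (@continuous_dotv _ _ p)).
rewrite inE => Pz; exists z => //; apply/eqP; rewrite eq_le; apply/andP; split.
  apply: ge_sup; first by exists (dotv p z); exists z.
  by move=> _ [w Pw <-]; apply: zmax; rewrite inE.
apply: sup_ubound; last by exists z.
by exists (dotv p z) => _ [w Pw <-]; apply: zmax; rewrite inE.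
Qed.

Lemma supp_near_set_ge H C y (p z : 'rV[R]_n.+1) : convex_lipschitz H C -> near_set H y z ->
  dotv p z <= supp (near_set H y) p.
Proof.
move=> HC Pz; apply: sup_ubound; last by exists z.
exists (enorm p * (enorm y + 2 * epi_dist H y)) => _ [w Pw <-].
apply: le_trans (cauchy_schwarz _ _) _.
by rewrite ler_wpM2l ?enorm_ge0//; exact: near_set_enorm.
Qed.

Lemma supp_near_set_lipschitz H C y (p q : 'rV[R]_n.+1) : convex_lipschitz H C ->
  `|supp (near_set H y) p - supp (near_set H y) q| <=
    (enorm y + 2 * epi_dist H y) * enorm (p - q).
Proof.
move=> HC.
have half (p' q' : 'rV[R]_n.+1) : supp (near_set H y) p' - supp (near_set H y) q' <=
    (enorm y + 2 * epi_dist H y) * enorm (p' - q').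
  have [z Pz ->] := supp_near_set_attained y p' HC.
  have := supp_near_set_ge q' HC Pz; have := cauchy_schwarz (p' - q') z.
  have := ler_wpM2l (enorm_ge0 (p' - q')) (near_set_enorm Pz).
  rewrite dotvBl; lra.
by have := half p q; have := half q p; rewrite (enormBC q p) ler_norml; lra.
Qed.

Lemma near_set_radius_ge0 H C y : convex_lipschitz H C -> 0 <= enorm y + 2 * epi_dist H y.
Proof. by move=> HC; have := epi_dist_ge0 y HC; have := enorm_ge0 y; lra. Qed.

Lemma selection_in H C y : convex_lipschitz H C -> near_set H y (selection H y).
Proof.
move=> HC; apply: (@cube_mean_in _ _ _ _ (enorm y + 2 * epi_dist H y)).
- exact: near_set_closed.
- exact: near_set_convex.
- exact: near_set_enorm.
- by move=> p; exact: supp_near_set_attained HC.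
- by move=> p z; exact: supp_near_set_ge HC.
Qed.

Lemma selection_conj_epi H C y : convex_lipschitz H C -> conj_epi H (selection H y).
Proof. by move=> /(selection_in y)[]. Qed.

Lemma selection_id H C y : convex_lipschitz H C -> conj_epi H y -> selection H y = y.
Proof. by move=> HC Ky; exact: near_set_mem HC Ky (selection_in y HC). Qed.

(** The factor 10 is that of [near_set_lipschitz], the factor [n.+1] that of the
    mean subgradient in dimension [n.+1]. *)
Lemma selection_lipschitz H H' C C' y y' rho r :
  convex_lipschitz H C -> convex_lipschitz H' C' -> 0 <= r ->
  excess_le rho r (conj_epi H) (conj_epi H') ->
  excess_le rho r (conj_epi H') (conj_epi H) ->
  enorm y + 2 * epi_dist H y <= rho -> enorm y' + 2 * epi_dist H' y' <= rho ->
  enorm (selection H y - selection H' y') <= 10 * n.+1%:R * (r + enorm (y - y')).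
Proof.
move=> HC HC' r0 KK' K'K yrho y'rho.
have half G G' (D D' : R) x x' (q : 'rV[R]_n.+1) : convex_lipschitz G D -> convex_lipschitz G' D' ->
    excess_le rho r (conj_epi G) (conj_epi G') ->
    excess_le rho r (conj_epi G') (conj_epi G) ->
    enorm x + 2 * epi_dist G x <= rho -> enorm x' + 2 * epi_dist G' x' <= rho ->
    supp (near_set G x) q - supp (near_set G' x') q <= 10 * (r + enorm (x - x')) * enorm q.
  move=> GD GD' GG' G'G xrho x'rho.
  have [z Pz ->] := supp_near_set_attained x q GD.
  have x'rho' : enorm x' + epi_dist G' x' <= rho.
    by apply: le_trans x'rho; have := epi_dist_ge0 x' GD'; lra.
  have [z' Pz' zz'] := near_set_lipschitz GD GD' r0 GG' G'G xrho x'rho' Pz.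
  have := supp_near_set_ge q GD' Pz'; have := cauchy_schwarz q (z - z').
  have := ler_wpM2l (enorm_ge0 q) zz'; rewrite dotvBr; lra.
rewrite -mulrA mulrCA; apply: (cube_mean_lipschitz (near_set_radius_ge0 y HC)
    (near_set_radius_ge0 y' HC')).
- by rewrite mulr_ge0// addr_ge0// enorm_ge0.
- by move=> p q; exact: supp_near_set_lipschitz HC.
- by move=> p q; exact: supp_near_set_lipschitz HC'.
move=> q; have := half _ _ _ _ y y' q HC HC' KK' K'K yrho y'rho.
have := half _ _ _ _ y' y q HC' HC K'K KK' y'rho yrho.
by rewrite (enormBC y' y) ler_norml; lra.
Qed.

Lemma conj_epi_excess H H' C' rho (a b : R) : convex_lipschitz H' C' ->
  0 <= a -> 0 <= b -> (forall p, H p - H' p <= a * enorm p + b) ->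
  excess_le rho (a + b) (conj_epi H) (conj_epi H').
Proof.
move=> HC' a0 b0 HH' z Kz _; apply: (conj_epi_dist HC'); first by rewrite addr_ge0.
move=> p; have := Kz p; have := HH' p.
have := ler_wpM2l a0 (enorm_slope_ge p); have := ler_wpM2l b0 (enorm_slope_ge1 p).
lra.
Qed.

(** A bound on a large ball of slopes is enough for the bounded part of the
    epigraph: by convexity, [H'] outside the ball is above its radial extension. *)
Lemma conj_epi_local_excess H H' C' rho (s e b : R) : convex_lipschitz H' C' ->
  1 <= s -> 0 <= e -> `|H' 0| <= b ->
  (forall p, enorm p <= s -> H p - H' p <= e) ->
  excess_le rho (e + (rho + b) / s) (conj_epi H) (conj_epi H').
Proof.
move=> HC' s1 e0 H'b HH' z Kz zrho; have [_ H'cvx _] := HC'.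
have s0 : 0 < s by lra.
have rb0 : 0 <= rho + b.
  by rewrite addr_ge0 ?(le_trans _ zrho) ?enorm_ge0 ?(le_trans _ H'b).
have rbs0 : 0 <= (rho + b) / s by rewrite divr_ge0// ltW.
apply: (conj_epi_dist HC'); first by rewrite addr_ge0.
move=> p; have slope1 := enorm_slope_ge1 p; have slope := enorm_slope_ge p.
have [ps|sp] := leP (enorm p) s.
  have := Kz p; have := HH' p ps; have : (e + (rho + b) / s) * 1 <=
    (e + (rho + b) / s) * enorm (pt (-1) p) by rewrite ler_wpM2l// addr_ge0.
  lra.
have p0 : 0 < enorm p by lra.
pose a := s / enorm p.
have ap : a * enorm p = s by rewrite /a divfK// gt_eqF.
have a0 : 0 < a by rewrite divr_gt0.
have a1 : a <= 1 by rewrite ler_pdivrMr// mul1r ltW.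
have qs : enorm (a *: p) <= s by rewrite enormZ gtr0_norm// ap.
have := H'cvx p 0 a; rewrite (ltW a0) a1 scaler0 addr0 => /(_ isT) H'q.
have Kq := Kz (a *: p); have HH'q := HH' _ qs.
rewrite -(ler_pM2l a0).
have hz : hd z <= rho by apply: le_trans zrho; apply: le_trans (normr_hd_le z); exact: ler_norm.
have hb : H' 0 <= b by apply: le_trans H'b; exact: ler_norm.
have bound : a * (dotv p (tl z) - hd z - H' p) <= e + (rho + b).
  have : (1 - a) * (hd z + H' 0) <= 1 * (rho + b).
    have [hh|hh] := leP 0 (hd z + H' 0); last first.
      by apply: (@le_trans _ _ 0); rewrite ?mul1r// mulr_ge0_le0 ?subr_ge0// ltW.
    by apply: ler_pM => //; rewrite ?subr_ge0 ?lerBlDr ?lerDl ?(ltW a0)//; lra.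
  rewrite dotvZl in Kq; rewrite mul1r; lra.
apply: le_trans bound _.
have sslope : s <= a * enorm (pt (-1) p) by rewrite -ap ler_wpM2l// ltW.
rewrite mulrCA; apply: (@le_trans _ _ ((e + (rho + b) / s) * s)).
  by rewrite mulrDl divfK ?gt_eqF// lerD2r ler_peMr.
by rewrite ler_wpM2l// addr_ge0.
Qed.

End Selection.

(** * Measurable dependence on a parameter *)

Section Measurability.
Context {R : realType} {d : measure_display} {T : measurableType d} {n : nat}.
Variable D : set T.
Hypothesis mD : measurable D.

Lemma continuous_max0 (S : topologicalType) (g : S -> R) x :
  {for x, continuous g} -> {for x, continuous (fun z => Num.max 0 (g z))}.
Proof. by apply: (continuous_max (f := fun=> 0)); exact: cst_continuous. Qed.

Definition rat_vec {m : nat} (k : nat) : 'rV[R]_m :=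
  map_mx ratr (odflt 0 (unpickle k : option 'rV[rat]_m)).

Lemma rat_vec_dense m (z : 'rV[R]_m) (A : set 'rV[R]_m) :
  nbhs z A -> exists k, A (rat_vec k).
Proof.
move=> /nbhs_ballP[e /= e0 eA].
have rat_near i : exists x : rat, `|z 0 i - ratr x| < e.
  have : z 0 i - e < z 0 i + e by lra.
  move=> /rat_in_itvoo[x]; rewrite in_itv/= => /andP[x1 x2].
  by exists x; rewrite ltr_norml; lra.
have [x xP] := choice rat_near.
exists (pickle (\row_i x i)); apply: eA; rewrite /rat_vec pickleK/=.
by split=> // i j; rewrite ord1 /ball/= !mxE.
Qed.

Lemma sup_rat_vec m (phi : 'rV[R]_m -> R) : continuous phi -> has_ubound (range phi) ->
  sup (range phi) = sups (fun k => phi (rat_vec k)) 0%N.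
Proof.
move=> phi_cont phi_ub; apply/eqP; rewrite eq_le; apply/andP; split.
  apply: ge_sup; first by apply: image_nonempty; exists 0.
  move=> _ [z _ <-]; rewrite leNgt; apply/negP => zlt.
  have [k] := rat_vec_dense (cvgr_gt _ (phi_cont z) _ zlt).
  rewrite /= ltNge => /negP; apply; apply: sup_ubound; last by exists k.
  by case: phi_ub => b phib; exists b => _ [j _ <-]; apply: phib; exists (rat_vec j).
apply: ge_sup; first by exists (phi (rat_vec 0)); exists 0%N.
by move=> _ [k _ <-]; apply: sup_ubound => //; exists (rat_vec k).
Qed.

(** By continuity the supremum is already attained in the limit along the
    countably many vectors with rational coordinates. *)
Lemma measurable_sup_continuous m (phi : T -> 'rV[R]_m -> R) :
  (forall z, measurable_fun D (fun t => phi t z)) ->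
  (forall t, D t -> continuous (phi t)) ->
  (forall t, D t -> has_ubound (range (phi t))) ->
  measurable_fun D (fun t => sup (range (phi t))).
Proof.
move=> phi_meas phi_cont phi_ub.
apply: (@eq_measurable_fun _ _ _ _ _ (fun t => sups (fun k => phi t (rat_vec k)) 0%N)).
  by move=> t; rewrite inE => Dt; rewrite (sup_rat_vec (phi_cont t Dt) (phi_ub t Dt)).
apply: (@measurable_fun_sups _ _ _ _ (fun k t => phi t (rat_vec k))) => // t Dt.
by have [b phib] := phi_ub t Dt; exists b => _ [j _ <-]; apply: phib; exists (rat_vec j).
Qed.

Lemma measurable_dotv m (p : 'rV[R]_m) (y : T -> 'rV[R]_m) :
  (forall i, measurable_fun D (fun t => y t 0 i)) ->
  measurable_fun D (fun t => dotv p (y t)).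
Proof.
move=> ym; rewrite /dotv.
by apply: measurable_sum => i; apply: measurable_funM.
Qed.

Lemma measurable_enormB m (z : 'rV[R]_m) (y : T -> 'rV[R]_m) :
  (forall i, measurable_fun D (fun t => y t 0 i)) ->
  measurable_fun D (fun t => enorm (z - y t)).
Proof.
move=> ym.
have sqrt_meas : measurable_fun [set: R] (@Num.sqrt R).
  by apply: continuous_measurable_fun => x; exact: sqrt_continuous.
have zym i : measurable_fun D (fun t => (z - y t) 0 i).
  under eq_fun do rewrite mxE [X in _ + X]mxE.
  exact: measurable_funB.
apply: (measurableT_comp sqrt_meas (g := fun t => dotv (z - y t) (z - y t))).
by apply: measurable_sum => i; apply: measurable_funM.
Qed.

(** Open sets are countable unions of boxes with rational centres. *)
Lemma measurable_fun_rV m (y : T -> 'rV[R]_m) :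
  (forall i, measurable_fun D (fun t => y t 0 i)) ->
  measurable_fun D (y : T -> g_sigma_algebraType (@open 'rV[R]_m)).
Proof.
move=> ym; apply: (@measurability _ _ T (g_sigma_algebraType (@open 'rV[R]_m)) D y
  (@open 'rV[R]_m)) => //.
move=> _ [U Uopen <-].
pose box (k l : nat) : set 'rV[R]_m := ball (rat_vec k : 'rV[R]_m) (l.+1%:R^-1).
have -> : D `&` y @^-1` U =
    \bigcup_(kl in [set kl : nat * nat | box kl.1 kl.2 `<=` U])
      (D `&` y @^-1` (box kl.1 kl.2)).
  apply/seteqP; split=> [t [Dt Uyt]|t [[k l] /= kU [Dt yt]]]; last by split=> //; exact: kU.
  have /nbhs_ballP[e /= e0 eU] := open_nbhs_nbhs (conj Uopen Uyt).
  have [l le] : exists l : nat, l.+1%:R^-1 < e / 2.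
    have /ltr_add_invr[l] : (0 : R) < e / 2 by lra.
    by rewrite add0r; exists l.
  have l0 : 0 < l.+1%:R^-1 :> R by rewrite invr_gt0.
  have [k kyt] := rat_vec_dense (nbhsx_ballx (y t) _ l0).
  exists (k, l) => /=; last by split=> //; exact: ball_sym.
  move=> w kw; apply: eU; apply: (@le_ball _ _ _ (l.+1%:R^-1 + l.+1%:R^-1)).
    by rewrite [leRHS]splitr; apply: ltW; exact: ltrD.
  exact: ball_triangle kyt kw.
rewrite bigcup_mkcond; apply: countable_bigcupT_measurable => [|[k l]].
  exact: countableP.
case: ifP => // _.
have -> : D `&` y @^-1` box k l = D `&` \bigcap_(i in [set: 'I_m])
    (D `&` (fun t => y t 0 i) @^-1` ball (rat_vec k 0 i : R) (l.+1%:R^-1)).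
  apply/seteqP; split=> t [Dt ty]; split=> //.
    by move=> i _; split=> //; case: ty => _ /(_ 0 i).
  split; first by rewrite invr_gt0.
  by move=> j i; rewrite ord1; have [] := ty i I.
apply: measurableI => //; apply: fin_bigcap_measurable => // i _.
by apply: ym => //; rewrite ball_itv; exact: measurable_itv.
Qed.

Lemma measurable_cube_mean m (g : T -> 'rV[R]_m -> R) (L : T -> R) i :
  (forall t, D t -> 0 <= L t) ->
  (forall t, D t -> forall p q, `|g t p - g t q| <= L t * enorm (p - q)) ->
  (forall p, measurable_fun D (fun t => g t p)) ->
  measurable_fun D (fun t => cube_mean (g t) 0 i).
Proof.
move=> L0 glip gm.
apply: (@measurable_fun_cvg _ _ _ _ (fun k t => grid_mean (g t) k i)); last first.
  by move=> t Dt; exact: (@cube_mean_cvg _ _ _ _ (L0 t Dt) (glip t Dt) i).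
move=> k; rewrite /grid_mean; move: (0 : 'rV[R]_m).
elim: (grid_steps _ k) => /= [|v s IH] p.
  by rewrite /cdiff; apply: measurable_funM => //; apply: measurable_funB.
by apply: measurable_funM => //; apply: measurable_funD.
Qed.

Variables (H : T -> 'rV[R]_n -> R) (C : T -> R) (y : T -> 'rV[R]_n.+1).
Hypotheses (HC : forall t, D t -> convex_lipschitz (H t) (C t))
  (Hm : forall p, measurable_fun D (fun t => H t p)).

Lemma measurable_epi_dist (z : T -> 'rV[R]_n.+1) :
  (forall i, measurable_fun D (fun t => z t 0 i)) ->
  measurable_fun D (fun t => epi_dist (H t) (z t)).
Proof.
move=> zm; apply: measurable_sup_continuous.
- move=> p; apply: measurable_maxr => //; apply: measurable_funM => //.
  apply: measurable_funB => //; under eq_fun do rewrite -dotv_slope.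
  exact: measurable_dotv.
- move=> t Dt p; apply: (@continuous_max0 'rV[R]_n).
  apply: continuousM.
    apply: continuousB; last exact: convex_lipschitz_continuous (HC Dt) p.
    apply: continuousB; last exact: cst_continuous.
    exact: continuous_dotvl.
  apply: continuousV; first by rewrite gt_eqF// enorm_slope_gt0.
  apply: continuous_comp; last exact: continuous_enorm.
  apply/(cvg_enormP (nbhs_filter p)) => e e0.
  apply: filterS (near_enorm_le p e0) => q.
  apply: le_trans; apply: le_trans (enorm_le_hd_tl _) _.
  by rewrite hdB tlB !hd_pt !tl_pt subrr normr0 add0r.
- by move=> t Dt; exact: (has_sup_violation (z t) (HC Dt)).2.
Qed.

(** The support function of the portion of the epigraph near [y] is an
    unconstrained maximum, the constraints being replaced by an exact penalty;
    this is what makes it measurable in the parameter. *)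
Lemma supp_near_set_penalty t (p : 'rV[R]_n.+1) : D t ->
  let penalty z := epi_dist (H t) z + Num.max 0 (enorm (z - y t) - 2 * epi_dist (H t) (y t)) in
  let phi z := dotv p z - 4 * enorm p * penalty z in
  has_ubound (range phi) /\ supp (near_set (H t) (y t)) p = sup (range phi).
Proof.
move=> Dt penalty phi; have HCt := HC Dt.
have phi_le z : phi z <= supp (near_set (H t) (y t)) p.
  have [z' Pz' zz'] := near_set_approx (y t) z HCt.
  have := supp_near_set_ge p HCt Pz'; have := cauchy_schwarz p (z - z').
  have := ler_wpM2l (enorm_ge0 p) zz'; rewrite dotvBr /phi -/(penalty z); lra.
have phi_ub : has_ubound (range phi).
  by exists (supp (near_set (H t) (y t)) p) => _ [z _ <-].
split=> //; apply/eqP; rewrite eq_le; apply/andP; split; last first.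
  by apply: ge_sup; [apply: image_nonempty; exists 0|move=> _ [z _ <-]].
have [z [Kz /= zy] ->] := supp_near_set_attained (y t) p HCt.
suff -> : dotv p z = phi z by apply: sup_ubound => //; exists z.
rewrite /phi /penalty (epi_dist_mem HCt Kz) max_l ?subr_le0//.
by rewrite addr0 mulr0 subr0.
Qed.

Hypothesis ym : forall i, measurable_fun D (fun t => y t 0 i).

Lemma measurable_supp_near_set p :
  measurable_fun D (fun t => supp (near_set (H t) (y t)) p).
Proof.
pose phi t z := dotv p z - 4 * enorm p *
  (epi_dist (H t) z + Num.max 0 (enorm (z - y t) - 2 * epi_dist (H t) (y t))).
apply: (@eq_measurable_fun _ _ _ _ _ (fun t => sup (range (phi t)))).
  by move=> t; rewrite inE => Dt; rewrite (supp_near_set_penalty p Dt).2.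
apply: measurable_sup_continuous.
- move=> z; apply: measurable_funB => //; apply: measurable_funM => //.
  apply: measurable_funD; first exact: measurable_epi_dist.
  apply: measurable_maxr => //; apply: measurable_funB.
    exact: measurable_enormB.
  by apply: measurable_funM => //; exact: measurable_epi_dist.
- move=> t Dt z; apply: continuousB; first exact: continuous_dotv.
  apply: continuousM; first exact: cst_continuous.
  apply: continuousD.
    apply/(@cvgrPdist_le _ _ _ _ (nbhs_filter z)) => e e0.
    apply: filterS (near_enorm_le z e0) => w /= wz.
    have := epi_dist_lipschitz w z (HC Dt); have := epi_dist_lipschitz z w (HC Dt).
    by rewrite (enormBC z w) ler_norml; lra.
  apply: (@continuous_max0 'rV[R]_n.+1).
  apply: continuousB; last exact: cst_continuous.
  exact: continuous_enormB.
- by move=> t Dt; exact: (supp_near_set_penalty p Dt).1.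
Qed.

Lemma measurable_selection i :
  measurable_fun D (fun t => selection (H t) (y t) 0 i).
Proof.
apply: (@measurable_cube_mean _ _ (fun t => enorm (y t) + 2 * epi_dist (H t) (y t))).
- by move=> t Dt; exact: near_set_radius_ge0 (HC Dt).
- by move=> t Dt p q; exact: supp_near_set_lipschitz (HC Dt).
- exact: measurable_supp_near_set.
Qed.

End Measurability.

(** * Continuous dependence on a parameter *)

Section Continuity.
Context {R : realType} {n : nat} {Z : Type}.
Variables (F : set_system Z) (H : Z -> 'rV[R]_n -> R) (C : Z -> R)
  (y : Z -> 'rV[R]_n.+1) (H0 : 'rV[R]_n -> R) (C0 : R) (y0 : 'rV[R]_n.+1) (b : R).
Hypotheses (FF : Filter F)
  (HC : \forall z \near F, convex_lipschitz (H z) (C z) /\ C z <= b)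
  (H0C : convex_lipschitz H0 C0) (C0b : C0 <= b)
  (Hb : \forall z \near F, `|H z 0| <= b) (H0b : `|H0 0| <= b)
  (yb : \forall z \near F, enorm (y z) <= b) (y0b : enorm y0 <= b)
  (Hcvg : forall p, (fun zq => H zq.1 zq.2) @ filter_prod F (nbhs p) --> H0 p)
  (ycvg : y @ F --> y0).

Lemma selection_radius_le (G : 'rV[R]_n -> R) (D : R) (x : 'rV[R]_n.+1) :
  convex_lipschitz G D -> D <= b -> `|G 0| <= b ->
  enorm x <= b -> enorm x + 2 * epi_dist G x <= 7 * b.
Proof. by move=> GD Db Gb xb; have := epi_dist_bound x GD; lra. Qed.

(** Pointwise convergence of [H], locally uniform by compactness of balls, controls
    the epigraphs up to an error inversely proportional to the size of the ball. *)
Lemma selection_cvg : (fun z => selection (H z) (y z)) @ F --> selection H0 y0.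
Proof.
apply/(cvg_enormP FF) => e e0.
have b0 : 0 <= b by apply: le_trans C0b; case: H0C.
pose m : R := 10 * n.+1%:R.
have m0 : 0 < m by rewrite mulr_gt0.
pose a := e / (3 * m).
have a0 : 0 < a by rewrite divr_gt0//; lra.
have ma : m * (a + a + a) = e by rewrite /a; field; rewrite gt_eqF.
pose s := 1 + 8 * b / a.
have bs : (7 * b + b) / s <= a.
  have s0 : 0 < s by rewrite /s ltr_pwDl// divr_ge0//; lra.
  rewrite ler_pdivrMr// /s mulrDr mulr1 mulrCA divff ?gt_eqF//; lra.
have s1 : 1 <= s by rewrite /s lerDl divr_ge0//; lra.
have unif : \forall z \near F, forall p, enorm p <= s -> `|H z p - H0 p| <= a.
  have /compact_near_coveringP cov := @compact_enorm_ball R n s.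
  apply: (cov Z F (fun z p => `|H z p - H0 p| <= a)) => p _.
  have a2 : 0 < a / 2 by lra.
  have H0cont := convex_lipschitz_continuous H0C (x := p).
  have near1 : \forall q \near p & z \near F, `|H z q - H0 p| <= a / 2.
    have /cvgrPdist_le/(_ _ a2)[[U V] [/= FU pV] UV] := @Hcvg p.
    exists (V, U) => //= -[q z] [/= Vq Uz].
    by have := UV (z, q) (conj Uz Vq); rewrite /= distrC.
  have near2 : \forall q \near p & z \near F, `|H0 p - H0 q| <= a / 2.
    have /(@cvgrPdist_le _ _ _ _ (nbhs_filter p))/(_ _ a2) := H0cont => near2.
    exists ([set q | `|H0 p - H0 q| <= a / 2], setT); last by move=> [q z] [].
    by split=> //; exact: filterT.
  apply: filterS2 near1 near2 => -[q z] /= h1 h2.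
  have -> : H z q - H0 q = (H z q - H0 p) + (H0 p - H0 q) by lra.
  by rewrite (le_trans (ler_normD _ _))// [leRHS]splitr lerD.
have /(cvg_enormP FF)/(_ _ a0) yz := ycvg.
near=> z.
have [HzC Czb] : convex_lipschitz (H z) (C z) /\ C z <= b by near: z.
have Hzb : `|H z 0| <= b by near: z.
have yzb : enorm (y z) <= b by near: z.
have Hz p : enorm p <= s -> `|H z p - H0 p| <= a by move: p; near: z.
have yzy0 : enorm (y z - y0) <= a by near: z.
apply: le_trans (selection_lipschitz (rho := 7 * b) (r := a + (7 * b + b) / s)
   HzC H0C _ _ _ _ _) _.
- by rewrite addr_ge0 ?divr_ge0//; lra.
- apply: (conj_epi_local_excess H0C s1 (ltW a0) H0b) => p /Hz.
  by rewrite ler_norml => /andP[].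
- apply: (conj_epi_local_excess HzC s1 (ltW a0) Hzb) => p /Hz.
  by rewrite ler_norml; lra.
- exact: selection_radius_le HzC Czb Hzb yzb.
- exact: selection_radius_le H0C C0b H0b y0b.
rewrite -/m -ma ler_wpM2l ?(ltW m0)//; lra.
Unshelve. all: by end_near. Qed.

End Continuity.

(** * Hamiltonians and their Lagrangians *)

Section Lagrangian.
Context {R : realType} {n : nat}.
Implicit Types (G : 'rV[R]_n -> R) (p v x : 'rV[R]_n) (z : 'rV[R]_n.+1) (t : R).

Lemma convex_function_combs G : convex_function [set: convex_lmodType 'rV[R]_n] G ->
  forall p q (a : R), 0 <= a <= 1 -> G (a *: p + (1 - a) *: q) <= a * G p + (1 - a) * G q.
Proof.
move=> Gcvx p q a /andP[a0 a1].
by have := Gcvx (Itv01 a0 a1) p q; apply; rewrite in_setT.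
Qed.

(** Otherwise the affine minorant of slope [tl z] would outgrow [G] along the
    ray spanned by [tl z]. *)
Lemma conj_epi_tl_le G C z : convex_lipschitz G C -> conj_epi G z -> enorm (tl z) <= C.
Proof.
move=> GC Kz; have [C0 _ _] := GC; rewrite leNgt; apply/negP => Cz.
set v := tl z in Cz *; have v0 : 0 < enorm v by lra.
pose B := `|G 0| + `|hd z| + 1; have B0 : 0 < B by rewrite ltr_wpDl// addr_ge0.
pose D := enorm v * (enorm v - C); have D0 : 0 < D by rewrite mulr_gt0// subr_gt0.
pose s : R := B / D; have s0 : 0 < s by rewrite divr_gt0.
have sD : s * D = B by rewrite divfK// gt_eqF.
have := Kz (s *: v); rewrite -/v dotvZl -sqr_enorm.
have := convex_lipschitz_le (s *: v) GC; rewrite enormZ (gtr0_norm s0).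
have := ler_norm (G (s *: v)); have := ler_norm (hd z); move: sD; rewrite /B /D; lra.
Qed.

Section AtPoint.
Variables (H : R -> 'rV[R]_n -> 'rV[R]_n -> R) (t : R) (x : 'rV[R]_n) (C : R).
Hypothesis HC : convex_lipschitz (H t x) C.

Lemma lagrangian_le_hd z : conj_epi (H t x) z ->
  (lagrangian H t x (tl z) <= (hd z)%:E)%E.
Proof.
move=> Kz; apply: ub_ereal_sup => _ [p _ <-]; rewrite lee_fin dotvC.
by have := Kz p; lra.
Qed.

Lemma edom_lagrangian_tl z : conj_epi (H t x) z -> edom (lagrangian H t x) (tl z).
Proof.
move=> Kz; split; first by rewrite lt_eqF// (le_lt_trans (lagrangian_le_hd Kz))// ltry.
rewrite gt_eqF//; apply: (@lt_le_trans _ _ (dotv (tl z) 0 - H t x 0)%:E).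
  exact: ltNyr.
by apply: ereal_sup_ubound; exists 0.
Qed.

Lemma lagrangian_conj_epi v : edom (lagrangian H t x) v ->
  conj_epi (H t x) (pt (fine (lagrangian H t x v)) v).
Proof.
move=> [Loo LNoo] p; rewrite hd_pt tl_pt.
have Lfin : lagrangian H t x v \is a fin_num by rewrite fin_numE LNoo.
have : ((dotv v p - H t x p)%:E <= lagrangian H t x v)%E by apply: ereal_sup_ubound; exists p.
by rewrite -[in X in (_ <= X)%E](fineK Lfin) lee_fin dotvC; lra.
Qed.

(** The graph of the Lagrangian over its domain lies in the ball of radius [m], so
    every one of its points is selected from itself. *)
Lemma selection_onto_graph (lm m : R) v :
  (lagrangian H t x v <= lm%:E)%E -> 0 < m -> `|lm| + `|H t x 0| + C <= m ->
  edom (lagrangian H t x) v ->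
  exists2 a, eball 1 a &
    selection (H t x) (m *: a) = pt (fine (lagrangian H t x v)) v.
Proof.
move=> Llm m0 lmm Lv; have Kz := lagrangian_conj_epi Lv.
set z := pt _ v in Kz *; have [Loo LNoo] := Lv.
have Lfin : lagrangian H t x v \is a fin_num by rewrite fin_numE LNoo.
have hlm : hd z <= lm by rewrite hd_pt -lee_fin fineK.
have hH := conj_epi_hd_ge Kz.
have vC : enorm (tl z) <= C := conj_epi_tl_le HC Kz.
have zm : enorm z <= m.
  apply: le_trans (enorm_le_hd_tl z) _; apply: le_trans lmm; apply: lerD => //.
  have := ler_norm lm; have := ler_norm (H t x 0).
  by have := normr_ge0 lm; have := normr_ge0 (H t x 0); rewrite ler_norml; lra.
exists (m^-1 *: z).
  by rewrite /eball/= enormZ gtr0_norm ?invr_gt0// mulrC ler_pdivrMr// mul1r.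
by rewrite scalerA mulfV ?gt_eqF// scale1r (selection_id HC Kz).
Qed.

(** The supremum over the selected points is the support function of the
    epigraph: replacing a height by the value of the Lagrangian only increases
    the supremum. *)
Lemma hamiltonian_sup (lm m : R) p :
  (forall v, edom (lagrangian H t x) v -> (lagrangian H t x v <= lm%:E)%E) ->
  0 < m -> `|lm| + `|H t x 0| + C <= m ->
  (H t x p)%:E = ereal_sup [set (dotv p (tl (selection (H t x) (m *: a))) -
      hd (selection (H t x) (m *: a)))%:E | a in eball 1].
Proof.
move=> Llm m0 lmm; apply/eqP; rewrite eq_le; apply/andP; split; last first.
  apply: ub_ereal_sup => _ [a _ <-]; rewrite lee_fin.
  exact: (selection_conj_epi _ HC) p.
apply/lee_addgt0Pr => e e0; have [z Kz ltz] := conj_epi_support p HC e0.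
have dz := edom_lagrangian_tl Kz.
have [a a1 sela] := selection_onto_graph (Llm _ dz) m0 lmm dz.
have Lz : fine (lagrangian H t x (tl z)) <= hd z.
  have [Loo LNoo] := dz.
  by rewrite -lee_fin fineK ?lagrangian_le_hd// fin_numE LNoo.
set S := ereal_sup _.
have aS : ((dotv p (tl z) - fine (lagrangian H t x (tl z)))%:E <= S)%E.
  by apply: ereal_sup_ubound; exists a => //; rewrite sela hd_pt tl_pt.
apply: le_trans (leeD2r e%:E aS); rewrite -EFinD lee_fin; lra.
Qed.

Lemma selection_tl_image (lm m : R) :
  (forall v, edom (lagrangian H t x) v -> (lagrangian H t x v <= lm%:E)%E) ->
  0 < m -> `|lm| + `|H t x 0| + C <= m ->
  [set tl (selection (H t x) (m *: a)) | a in eball 1] = edom (lagrangian H t x).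
Proof.
move=> Llm m0 lmm; apply/seteqP; split=> [_ [a _ <-]|v dv].
  by apply: edom_lagrangian_tl; exact: selection_conj_epi HC.
have [a a1 sela] := selection_onto_graph (Llm _ dv) m0 lmm dv.
by exists a => //; rewrite sela tl_pt.
Qed.

End AtPoint.

Lemma selection_lipschitz_param G G' C C' (m m' k w : R) (a : 'rV[R]_n.+1) :
  convex_lipschitz G C -> convex_lipschitz G' C' -> 0 <= k -> 0 <= w ->
  (forall p, `|G p - G' p| <= k * enorm p + w) -> eball 1 a ->
  enorm (selection G (m *: a) - selection G' (m' *: a)) <=
    10 * n.+1%:R * (k + w + `|m - m'|).
Proof.
move=> GC G'C k0 w0 GG' a1.
pose rad (D : 'rV[R]_n -> R) (x : 'rV[R]_n.+1) := enorm x + 2 * epi_dist D x.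
apply: le_trans (selection_lipschitz (rho := Num.max (rad G (m *: a)) (rad G' (m' *: a)))
  (r := k + w) GC G'C _ _ _ _ _) _.
- exact: addr_ge0.
- by apply: (conj_epi_excess G'C) => // p; have := GG' p; rewrite ler_norml; lra.
- by apply: (conj_epi_excess GC) => // p; have := GG' p; rewrite ler_norml; lra.
- by rewrite le_max lexx.
- by rewrite le_max lexx orbT.
rewrite ler_wpM2l ?mulr_ge0// lerD2l -scalerBl enormZ.
by rewrite -[leRHS]mulr1 ler_wpM2l.
Qed.

Lemma selection_lipschitz_point G C (m : R) (a b : 'rV[R]_n.+1) : convex_lipschitz G C -> 0 <= m ->
  enorm (selection G (m *: a) - selection G (m *: b)) <= 10 * n.+1%:R * m * enorm (a - b).
Proof.
move=> GC m0; pose rad (x : 'rV[R]_n.+1) := enorm x + 2 * epi_dist G x.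
have GG : excess_le (Num.max (rad (m *: a)) (rad (m *: b))) 0 (conj_epi G) (conj_epi G).
  by move=> z Kz _; exists z => //; rewrite subrr enorm0.
apply: le_trans (selection_lipschitz GC GC (lexx 0) GG GG _ _) _.
- by rewrite le_max lexx.
- by rewrite le_max lexx orbT.
by rewrite add0r -scalerBr enormZ ger0_norm// mulrA.
Qed.

End Lagrangian.

Section ContinuousSelection.
Context {R : realType} {n : nat}.
Variables (T : R) (H : R -> 'rV[R]_n -> 'rV[R]_n -> R) (lam : R -> 'rV[R]_n -> R) (c : R -> R).
Hypothesis HC : forall t x, 0 <= t <= T -> convex_lipschitz (H t x) (c t * (1 + enorm x)).

Local Notation M := (Mbound H lam c).

Lemma Mbound_ge t x : 0 <= t <= T ->
  [/\ c t * (1 + enorm x) <= M t x, `|H t x 0| <= M t x, 0 < M t x &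
      `|lam t x| + `|H t x 0| + c t * (1 + enorm x) <= M t x].
Proof.
move=> /(HC x)[C0 _ _]; have := normr_ge0 (lam t x); have := normr_ge0 (H t x 0).
by rewrite /Mbound; split; lra.
Qed.

Lemma enorm_Mbound_scale t x a : 0 <= t <= T -> eball 1 a ->
  enorm (M t x *: a : 'rV[R]_n.+1) <= M t x.
Proof.
move=> tT a1; have [_ _ M0 _] := Mbound_ge x tT.
by rewrite enormZ gtr0_norm// -[leRHS]mulr1 ler_wpM2l// ltW.
Qed.

Lemma selection_Mbound_cvg {Z : Type} (F : set_system Z) (FF : Filter F)
    (tz : Z -> R) (xz : Z -> 'rV[R]_n) (az : Z -> 'rV[R]_n.+1) t0 x0 a0 :
  (\forall z \near F, 0 <= tz z <= T) -> 0 <= t0 <= T ->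
  (\forall z \near F, eball 1 (az z)) -> eball 1 a0 ->
  xz @ F --> x0 -> az @ F --> a0 ->
  (forall p, (fun zq => H (tz zq.1) (xz zq.1) zq.2) @ filter_prod F (nbhs p) --> H t0 x0 p) ->
  (fun z => lam (tz z) (xz z)) @ F --> lam t0 x0 ->
  (fun z => c (tz z)) @ F --> c t0 ->
  (fun z => selection (H (tz z) (xz z)) (M (tz z) (xz z) *: az z)) @ F -->
    selection (H t0 x0) (M t0 x0 *: a0).
Proof.
move=> tzT t0T az1 a01 xzx0 aza0 Hcvg lamcvg ccvg.
have H0cvg : (fun z => H (tz z) (xz z) 0) @ F --> H t0 x0 0.
  have pair0 : (fun z => (z, 0 : 'rV[R]_n)) @ F --> filter_prod F (nbhs (0 : 'rV[R]_n)).
    move=> A [[U V] [/= FU V0] UV]; apply: (@filterS _ F _ U) => // z Uz.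
    by apply: (UV (z, 0)); split=> //=; exact: (nbhs_singleton V0).
  exact: cvg_comp pair0 (Hcvg 0).
have Mcvg : (fun z => M (tz z) (xz z)) @ F --> M t0 x0.
  apply: cvgD; last exact: cvg_cst.
  apply: cvgD; first by apply: cvgD; apply: cvg_norm.
  apply: cvgM => //; apply: cvgD; first exact: cvg_cst.
  exact: cvg_comp xzx0 (@continuous_enorm R n x0).
have [C0M H0M M0 _] := Mbound_ge x0 t0T.
have Mnear : \forall z \near F, M (tz z) (xz z) <= M t0 x0 + 1.
  by apply: (cvgr_le _ Mcvg); rewrite ltrDl.
apply: (@selection_cvg _ _ _ _ _ (fun z => c (tz z) * (1 + enorm (xz z))) _ _
    (c t0 * (1 + enorm x0)) _ (M t0 x0 + 1)) => //.
- near=> z; have zT : 0 <= tz z <= T by near: z.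
  have [CM _ _ _] := Mbound_ge (xz z) zT; split; first exact: HC.
  by apply: le_trans CM _; near: z.
- exact: HC.
- lra.
- near=> z; have zT : 0 <= tz z <= T by near: z.
  have [_ HM _ _] := Mbound_ge (xz z) zT.
  by apply: le_trans HM _; near: z.
- lra.
- near=> z; have zT : 0 <= tz z <= T by near: z.
  have z1 : eball 1 (az z) by near: z.
  by apply: le_trans (enorm_Mbound_scale (xz z) zT z1) _; near: z.
- by apply: le_trans (enorm_Mbound_scale x0 t0T a01) _; lra.
- exact: cvgZ.
Unshelve. all: by end_near. Qed.

End ContinuousSelection.

Lemma cvg_to_within {X Y : Type} (F : set_system X) {FF : Filter F}
    (G : set_system Y) (E : set Y) (f : X -> Y) :
  f @ F --> G -> (\forall x \near F, E (f x)) -> f @ F --> within E G.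
Proof.
by move=> fG fE A GA; have := fG _ GA; apply: filterS2 fE => x Ex /= AE; exact: AE.
Qed.

Lemma cvg_prod_first {X Y W : Type} (F : set_system X) (G : set_system Y) (K : set_system W)
    (f : X -> Y) : f @ F --> G ->
  (fun xw => (f xw.1, xw.2)) @ filter_prod F K --> filter_prod G K.
Proof.
move=> fG A [[U V] [/= GU KV] UV].
exists (f @^-1` U, V); first by split=> //; exact: fG.
by move=> [x w'] [/= Ux Vw]; exact: (UV (f x, w')).
Qed.

(** * The representation theorem *)

Lemma lebesgueTypeR_itv {R : realType} (a b : R) :
  measurable (`[a, b] : set (lebesgueTypeR R)).
Proof.
apply: sub_sigma_algebra; exists `[a, b]%classic; first exact: measurable_itv.
by exists set0; [exact: negligible_set0|rewrite setU0].
Qed.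

Theorem theorem3p6 (R : realType) (n : nat) (T : R)
  (H : R -> 'rV[R]_n -> 'rV[R]_n -> R)
  (c : R -> R)
  (k : R -> R -> R) (w : R -> R -> R -> R) (N : R -> set R)
  (lam : R -> 'rV[R]_n -> R)
  (H_meas : forall x p, lebesgue_measurable_fun `[0, T] (fun t => H t x p))
  (H_cont : forall t : R, 0 <= t <= T ->
     continuous (fun z : 'rV[R]_n * 'rV[R]_n => H t z.1 z.2))
  (H_convex : forall (t : R) x, 0 <= t <= T ->
     convex_function [set: convex_lmodType 'rV[R]_n] (H t x))
  (c_meas : lebesgue_measurable_fun `[0, T] c)
  (c_ge0 : forall t : R, 0 <= t <= T -> 0 <= c t)
  (H_lip : forall (t : R) x p q, 0 <= t <= T ->
     `|H t x p - H t x q| <= c t * (1 + enorm x) * enorm (p - q))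
  (k_meas : forall r : R, 0 < r -> lebesgue_measurable_fun `[0, T] (k r))
  (k_ge0 : forall r t : R, 0 < r -> 0 <= t <= T -> 0 <= k r t)
  (w_modulus : forall r : R, 0 < r -> modulus T (w r))
  (N_null : forall r : R, 0 < r -> null_subset T (N r))
  (H_x : forall r : R, 0 < r -> forall (t : R) x y p,
     (`[0, T]%classic `\` N r) t -> eball r x -> eball r y ->
     `|H t x p - H t y p| <=
       k r t * enorm p * enorm (x - y) + w r t (enorm (x - y)))
  (lam_meas : forall x, lebesgue_measurable_fun `[0, T] (lam ^~ x))
  (lam_cont : forall t : R, 0 <= t <= T -> continuous (lam t))
  (L_le_lam : forall (t : R) x v, 0 <= t <= T -> edom (lagrangian H t x) v ->
     (lagrangian H t x v <= (lam t x)%:E)%E)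
  (lam_x : forall r : R, 0 < r -> exists (w' : R -> R -> R) (N' : set R),
     [/\ modulus T w', null_subset T N' &
         forall (t : R) x y,
           (`[0, T]%classic `\` N') t -> eball r x -> eball r y ->
           `|lam t x - lam t y| <= w' t (enorm (x - y))]) :
  let A : set 'rV[R]_n.+1 := eball 1 in
  let M := Mbound H lam c in
  exists (f : R -> 'rV[R]_n -> 'rV[R]_n.+1 -> 'rV[R]_n)
         (l : R -> 'rV[R]_n -> 'rV[R]_n.+1 -> R),
    (forall x a, A a ->
       lebesgue_measurable_vfun `[0, T] (fun t => f t x a) /\
       lebesgue_measurable_fun `[0, T] (fun t => l t x a)) /\
    (forall t : R, 0 <= t <= T ->
       {within [set: 'rV[R]_n] `*` A, continuous (fun z => f t z.1 z.2)} /\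
       {within [set: 'rV[R]_n] `*` A, continuous (fun z => l t z.1 z.2)}) /\
    (forall (t : R) x p, 0 <= t <= T ->
       (H t x p)%:E = ereal_sup [set (dotv p (f t x a) - l t x a)%:E | a in A]) /\
    (forall (t : R) x, 0 <= t <= T -> f t x @` A = edom (lagrangian H t x)) /\
    (* (A1) *)
    (forall r : R, 0 < r -> forall (t : R) x y a b,
       (`[0, T]%classic `\` N r) t -> eball r x -> eball r y -> A a -> A b ->
       enorm (f t x a - f t y a) <=
         10 * n.+1%:R * (k r t * enorm (x - y) + w r t (enorm (x - y))
                         + `|M t x - M t y|) /\
       enorm (f t x a - f t x b) <= 10 * n.+1%:R * M t x * enorm (a - b)) /\
    (* (A2) *)
    (forall (t : R) x a, 0 <= t <= T -> A a ->
       enorm (f t x a) <= c t * (1 + enorm x)) /\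
    (* (A3) *)
    (forall r : R, 0 < r -> forall (t : R) x y a b,
       (`[0, T]%classic `\` N r) t -> eball r x -> eball r y -> A a -> A b ->
       `|l t x a - l t y a| <=
         10 * n.+1%:R * (k r t * enorm (x - y) + w r t (enorm (x - y))
                         + `|M t x - M t y|) /\
       `|l t x a - l t x b| <= 10 * n.+1%:R * M t x * enorm (a - b)) /\
    (* (A4) *)
    ({within [set z : R * 'rV[R]_n * 'rV[R]_n | 0 <= z.1.1 <= T],
        continuous (fun z => H z.1.1 z.1.2 z.2)} ->
     {within [set z : R * 'rV[R]_n | 0 <= z.1 <= T],
        continuous (fun z => lam z.1 z.2)} ->
     {within `[0, T], continuous c} ->
     {within [set z : R * 'rV[R]_n * 'rV[R]_n.+1 | 0 <= z.1.1 <= T /\ A z.2],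
        continuous (fun z => f z.1.1 z.1.2 z.2)} /\
     {within [set z : R * 'rV[R]_n * 'rV[R]_n.+1 | 0 <= z.1.1 <= T /\ A z.2],
        continuous (fun z => l z.1.1 z.1.2 z.2)}).
Proof.
move=> A M.
have itvT (t : R) : `[0, T]%classic t <-> 0 <= t <= T by rewrite /= in_itv.
have HC t x : 0 <= t <= T -> convex_lipschitz (H t x) (c t * (1 + enorm x)).
  move=> tT; split; last by move=> p q; exact: H_lip.
    by rewrite mulr_ge0 ?c_ge0// addr_ge0 ?enorm_ge0.
  exact: convex_function_combs (H_convex t x tT).
have Mge t x (tT : 0 <= t <= T) := Mbound_ge lam HC x tT.
have Llam t x (tT : 0 <= t <= T) v := L_le_lam t x v tT.
pose sel t x a := selection (H t x) (M t x *: a).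
exists (fun t x a => tl (sel t x a)), (fun t x a => hd (sel t x a)).
have sel_meas x a i : measurable_fun (`[0, T] : set (lebesgueTypeR R))
    (fun t : lebesgueTypeR R => sel t x a 0 i).
  apply: (@measurable_selection _ _ (lebesgueTypeR R) n _
    (fun t => H t x) (fun t => c t * (1 + enorm x)) (fun t => M t x *: a)).
  - by move=> t /itvT; exact: HC.
  - by move=> p; exact: H_meas.
  - move=> j; rewrite (_ : (fun t => _) = (fun t => M t x * a 0 j)); last first.
      by apply/funext => t; rewrite mxE.
    apply: measurable_funM => //; rewrite /M /Mbound.
    apply: measurable_funD => //; apply: measurable_funD.
      by apply: measurable_funD; apply: measurableT_comp => //; [exact: lam_meas|exact: H_meas].
    exact: measurable_funM.
have sel_cvg Z (F : set_system Z) (FF : Filter F) (tz : Z -> R) xz az t0 x0 a0 :=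
  @selection_Mbound_cvg _ _ T H lam c HC Z F FF tz xz az t0 x0 a0.
have sel_x r t x y a : 0 < r -> (`[0, T]%classic `\` N r) t -> eball r x -> eball r y -> A a ->
    enorm (sel t x a - sel t y a) <= 10 * n.+1%:R *
      (k r t * enorm (x - y) + w r t (enorm (x - y)) + `|M t x - M t y|).
  move=> r0 tN xr yr a1; have [/itvT tT _] := tN; rewrite /sel.
  have := @selection_lipschitz_param _ _ _ _ _ _ (M t x) (M t y)
    (k r t * enorm (x - y)) (w r t (enorm (x - y))) a (HC t x tT) (HC t y tT).
  apply => //.
  - by rewrite mulr_ge0 ?enorm_ge0// k_ge0.
  - by have [w_ge0 _ _] := w_modulus r r0; rewrite w_ge0 ?enorm_ge0.
  - by move=> p; rewrite mulrAC; exact: H_x.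
have sel_a r t x a b : (`[0, T]%classic `\` N r) t ->
    enorm (sel t x a - sel t x b) <= 10 * n.+1%:R * M t x * enorm (a - b).
  move=> [/itvT tT _]; have [_ _ /ltW M0 _] := Mge t x tT.
  exact: selection_lipschitz_point (HC t x tT) M0.
split; [|split; [|split; [|split; [|split; [|split; [|split]]]]]].
- move=> x a _; split; last exact: sel_meas.
  apply: (measurable_fun_rV (lebesgueTypeR_itv 0 T)) => i.
  rewrite (_ : (fun t => _) = (fun t => sel t x a 0 (lift ord0 i))); last first.
    by apply/funext => t; rewrite mxE.
  exact: sel_meas.
- move=> t tT.
  have sel_cont : {within [set: 'rV[R]_n] `*` A, continuous (fun z => sel t z.1 z.2)}.
    apply/subspace_continuousP => -[x0 a0] [_ /= a01].
    set F := within _ _; have FF : Filter F by exact: within_filter.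
    have idF : id @ F --> (x0, a0) by exact: cvg_within.
    have xcvg : (fun z : 'rV[R]_n * 'rV[R]_n.+1 => z.1) @ F --> x0 by exact: cvg_comp idF cvg_fst.
    apply: (sel_cvg _ F FF (fun=> t) fst snd t x0 a0) => //.
    + exact: nearW.
    + by apply: filterS (withinT _ _) => // -[x a] [].
    + exact: cvg_comp idF cvg_snd.
    + move=> p; exact: cvg_comp (cvg_prod_first (K := nbhs p) xcvg) (H_cont t tT (x0, p)).
    + exact: cvg_comp xcvg (lam_cont t tT x0).
    + exact: cvg_cst.
  split; apply/subspace_continuousP => z Dz.
  + move/subspace_continuousP : sel_cont => /(_ z Dz) sel_z.
    exact: cvg_comp sel_z (@continuous_tl _ _ _).
  + move/subspace_continuousP : sel_cont => /(_ z Dz) sel_z.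
    exact: cvg_comp sel_z (@continuous_hd _ _ _).
- move=> t x p tT; have [_ _ M0 lM] := Mge t x tT.
  exact: (hamiltonian_sup (HC t x tT) p (Llam t x tT) M0 lM).
- move=> t x tT; have [_ _ M0 lM] := Mge t x tT.
  exact: (selection_tl_image (HC t x tT) (Llam t x tT) M0 lM).
- move=> r r0 t x y a b tN xr yr a1 b1.
  split; rewrite -tlB (le_trans (enorm_tl_le _))//; first exact: sel_x.
  exact: sel_a tN.
- move=> t x a tT _.
  exact: conj_epi_tl_le (HC t x tT) (selection_conj_epi _ (HC t x tT)).
- move=> r r0 t x y a b tN xr yr a1 b1.
  split; rewrite -hdB (le_trans (normr_hd_le _))//; first exact: sel_x.
  exact: sel_a tN.
- move=> /subspace_continuousP H_jcont /subspace_continuousP lam_jcont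
    /subspace_continuousP c_jcont.
  pose D := [set z : R * 'rV[R]_n * 'rV[R]_n.+1 | 0 <= z.1.1 <= T /\ A z.2].
  have sel_cont : forall z, D z ->
      (fun z => sel z.1.1 z.1.2 z.2) @ within D (nbhs z) --> sel z.1.1 z.1.2 z.2.
    move=> [[t0 x0] a0] [/= t0T a01].
    set F := within _ _; have FF : Filter F by exact: within_filter.
    have nearD : \forall z \near F, D z by exact: withinT.
    have nearT : \forall z \near F, 0 <= z.1.1 <= T by apply: filterS nearD => z [].
    have idF : id @ F --> (t0, x0, a0) by exact: cvg_within.
    have txcvg : (fun z : R * 'rV[R]_n * 'rV[R]_n.+1 => z.1) @ F --> (t0, x0).
      exact: cvg_comp idF cvg_fst.
    have tcvg : (fun z : R * 'rV[R]_n * 'rV[R]_n.+1 => z.1.1) @ F --> t0.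
      exact: cvg_comp txcvg cvg_fst.
    apply: (sel_cvg _ F FF (fun z => z.1.1) (fun z => z.1.2) snd t0 x0 a0) => //.
    + by apply: filterS nearD => z [].
    + exact: cvg_comp txcvg cvg_snd.
    + exact: cvg_comp idF cvg_snd.
    + move=> p; pose DH := [set z : R * 'rV[R]_n * 'rV[R]_n | 0 <= z.1.1 <= T].
      have H_cvg : (fun z => H z.1.1 z.1.2 z.2) @ within DH (nbhs (t0, x0, p)) --> H t0 x0 p.
        exact: (H_jcont (t0, x0, p) t0T).
      have near_DH : \forall zq \near filter_prod F (nbhs p), DH (zq.1.1, zq.2).
        exists ([set z | 0 <= z.1.1 <= T], setT); last by move=> [z q] [].
        by split=> //; exact: filterT.
      exact: cvg_comp (cvg_to_within (cvg_prod_first txcvg) near_DH) H_cvg.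
    + pose Dl := [set z : R * 'rV[R]_n | 0 <= z.1 <= T].
      have lam_cvg : (fun z => lam z.1 z.2) @ within Dl (nbhs (t0, x0)) --> lam t0 x0.
        exact: (lam_jcont (t0, x0) t0T).
      exact: cvg_comp (cvg_to_within txcvg nearT) lam_cvg.
    + have c_cvg : c @ within `[0, T] (nbhs t0) --> c t0.
        exact: (c_jcont t0 ((itvT t0).2 t0T)).
      have near_itv : \forall z \near F, `[0, T]%classic z.1.1.
        by apply: filterS nearT => z /itvT.
      exact: cvg_comp (cvg_to_within tcvg near_itv) c_cvg.
  split; apply/subspace_continuousP => z Dz.
    exact: cvg_comp (sel_cont z Dz) (@continuous_tl _ _ _).
  exact: cvg_comp (sel_cont z Dz) (@continuous_hd _ _ _).
Qed.
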